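(* Let $\Omega\subseteq\mathbb R^2$ be a connected open subset of $\mathbb R^2$. Then the annihilator $\mathcal Q(\Omega)^\dagger\subseteq S^{-1}R$ is the differential ideal of $S^{-1}R$ generated by the two elements $$\begin{aligned} &\partial^{(3,0)}(\partial^{(0,2)})^2-3 \partial^{(1,2)} \partial^{(2,0)} \partial^{(0,2)}+2 \partial^{(0,3)} \partial^{(1,1)} \partial^{(2,0)}, \\ &\partial^{(0,3)}(\partial^{(2,0)})^2-3 \partial^{(2,1)} \partial^{(0,2)} \partial^{(2,0)}+2 \partial^{(3,0)} \partial^{(1,1)} \partial^{(0,2)}. \end{aligned}$$
   Context: Let $R=\mathbb R[x,y,\partial^{(0,0)},\partial^{(0,1)},\partial^{(1,0)},\ldots]$ be the commutative polynomial ring over $\mathbb R$ in the variables $x$, $y$ and the formal partial derivatives $\partial^{(i,j)}$, $i,j\ge 0$. Let $S=\langle\partial^{(0,2)},\partial^{(2,0)},\partial^{(0,2)}\partial^{(2,0)}-(\partial^{(1,1)})^2\rangle$ be the submonoid of the multiplicative monoid of $R$ generated by the listed elements, and let $S^{-1}R$ be the localization of $R$ at $S$. Let $D_x,D_y:S^{-1}R\to S^{-1}R$ be the derivations ($\mathbb R$-linear endomorphisms of the additive group satisfying the Leibniz rule $D(r_1r_2)=D(r_1)r_2+r_1D(r_2)$) determined by $D_x(x)=1$, $D_x(y)=0$, $D_x(\partial^{(i,j)})=\partial^{(i+1,j)}$, and $D_y(x)=0$, $D_y(y)=1$, $D_y(\partial^{(i,j)})=\partial^{(i,j+1)}$. This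 makes $S^{-1}R$ a differential ring. A differential ideal is an ideal mapped to itself by each derivation; the differential ideal generated by a set is the smallest differential ideal containing it. A smooth function $f:\Omega\to\mathbb R$ is called generic if none of the expressions $f^{(0,2)}(x,y)$, $f^{(2,0)}(x,y)$, $f^{(0,2)}(x,y)f^{(2,0)}(x,y)-f^{(1,1)}(x,y)^2$ takes a zero value on $\Omega$, where $f^{(i,j)}$ denotes the partial derivative of $f$ taken $i$ times in $x$ and $j$ times in $y$. An element $T\in S^{-1}R$ acts on generic functions as a differential operator: $Tf:\Omega\to\mathbb R$ is the function obtained by replacing each $\partial^{(i,j)}$ by $f^{(i,j)}(x,y)$ and $x,y$ by the coordinates. Let $\mathcal G(\Omega)$ be the set of generic functions $f:\Omega\to\mathbb R$ and $\mathcal Q(\Omega)\subseteq\mathcal G(\Omega)$ the subset of parametrizations of quadratic surfaces, i.e. of those $f$ for which there are real constants $a_{11},a_{12},a_{13},a_{22},a_{23},a_{33},b_1,b_2,b_3,c$, not all zero, such that $a_{11} x^2+a_{12} x y+a_{13} x f+a_{22} y^2+a_{23} y f+a_{33} f^2+b_1 x+b_2 y+b_3 f+c = 0$ for all $(x,y)\in\Omega$, with $f=f(x,y)$. For $X\subseteq\mathcal G(\Omega)$, the annihilator is $X^\dagger=\{T\in S^{-1}R: Tf=0\text{ for all } f\in X\}$. *)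

(* Defs.v *)
From HB Require Import structures.
From mathcomp Require Import all_boot all_order all_algebra.
From mathcomp Require Import generic_quotient finmap ring.
From mathcomp Require Import boolp classical_sets reals topology normedtype derive.
From mathcomp Require monalg.
(* The notations of [monalg] conflict with those of mathcomp-analysis. *)
Import -(notations) monalg.
Import GRing.Theory Num.Theory numFieldNormedType.Exports.

Set Implicit Arguments.
Unset Strict Implicit.
Unset Printing Implicit Defensive.

Local Open Scope classical_set_scope.
Local Open Scope quotient_scope.
Local Open Scope ring_scope.

Definition submonoid_closed (P : pzRingType) (M : set P) : Prop :=
  M 1 /\ (forall a b, M a -> M b -> M (a * b)).

Definition submonoid_gen (P : pzRingType) (G : set P) : set P :=
  smallest (@submonoid_closed P) G.

Definition in_submonoid (P : pzRingType) (G : set P) : {pred P} :=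
  [pred r | `[< submonoid_gen G r >]].

Lemma in_submonoidE (P : pzRingType) (G : set P) r :
  (r \in in_submonoid G) = `[< submonoid_gen G r >].
Proof. by []. Qed.

Lemma in_submonoid_gen (P : pzRingType) (G : set P) r :
  G r -> r \in in_submonoid G.
Proof. by move=> Gr; apply/asboolP => M [_]; exact. Qed.

Section SubmonoidClosed.
Context (P : pzRingType) (G : set P).

Fact in_submonoid1 : 1 \in in_submonoid G.
Proof. by apply/asboolP => M [[]]. Qed.

Fact in_submonoidM : GRing.mulr_2closed (in_submonoid G).
Proof.
move=> a b /asboolP Ga /asboolP Gb; apply/asboolP => M MG; have [[_ MM] _] := MG.
by apply: MM; [exact: Ga | exact: Gb].
Qed.

HB.instance Definition _ := GRing.isMulClosed.Build P (in_submonoid G)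
  (conj in_submonoid1 in_submonoidM).
End SubmonoidClosed.

Section Localization.
Context (P : comNzRingType) (S : mulrClosed P).

Local Notation den := {s : P | s \in S}.
Local Notation pre := (P * den)%type.

Definition den1 : den := exist _ 1 (rpred1 S).
Definition denM (s t : den) : den :=
  exist _ (val s * val t) (rpredM (valP s) (valP t)).

Definition loc_rel (a b : pre) : bool :=
  `[< exists2 t, t \in S & t * (a.1 * val b.2 - b.1 * val a.2) = 0 >].

Fact loc_rel_refl : reflexive loc_rel.
Proof.
by move=> a; apply/asboolP; exists 1; rewrite ?rpred1 // subrr mulr0.
Qed.

Fact loc_rel_sym : symmetric loc_rel.
Proof.
suff H a b : loc_rel a b -> loc_rel b a by move=> a b; apply/idP/idP; exact: H.
move=> /asboolP[t tS e]; apply/asboolP; exists t => //.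
by rewrite -opprB mulrN e oppr0.
Qed.

Fact loc_rel_trans : transitive loc_rel.
Proof.
move=> b a c /asboolP[t tS e] /asboolP[u uS e'].
apply/asboolP; exists (t * u * val b.2).
  by rewrite !rpredM //; exact: valP.
transitivity (u * val c.2 * (t * (a.1 * val b.2 - b.1 * val a.2))
              + t * val a.2 * (u * (b.1 * val c.2 - c.1 * val b.2))); first by rewrite /=; ring.
by rewrite e e' !mulr0 addr0.
Qed.

Canonical loc_equiv := EquivRel loc_rel loc_rel_refl loc_rel_sym loc_rel_trans.

Definition loc := {eq_quot loc_rel}.
HB.instance Definition _ := Choice.on loc.
HB.instance Definition _ := EqQuotient.on loc.

Definition frac (r : P) (s : den) : loc := \pi_loc (r, s).

Definition num (a : loc) : P := (repr a).1.
Definition dnm (a : loc) : den := (repr a).2.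

Lemma frac_eqP r s r' s' :
  reflect (exists2 t, t \in S & t * (r * val s' - r' * val s) = 0)
          (frac r s == frac r' s').
Proof. by rewrite /frac eqmodE /=; exact: asboolP. Qed.

Lemma frac_num_dnm a : frac (num a) (dnm a) = a.
Proof. by rewrite /frac /num /dnm -surjective_pairing reprK. Qed.

Lemma num_dnm_frac r s : exists2 t, t \in S &
  t * (num (frac r s) * val s - r * val (dnm (frac r s))) = 0.
Proof. by apply/frac_eqP; rewrite frac_num_dnm. Qed.

Lemma fracW (Q : loc -> Prop) : (forall r s, Q (frac r s)) -> forall a, Q a.
Proof. by move=> H a; rewrite -(frac_num_dnm a). Qed.

Definition loc0 := frac 0 den1.
Definition loc1 := frac 1 den1.
Definition loc_opp a := frac (- num a) (dnm a).
Definition loc_add a b :=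
  frac (num a * val (dnm b) + num b * val (dnm a)) (denM (dnm a) (dnm b)).
Definition loc_mul a b := frac (num a * num b) (denM (dnm a) (dnm b)).

Lemma loc_oppE r s : loc_opp (frac r s) = frac (- r) s.
Proof.
rewrite /loc_opp; have [t tS e] := num_dnm_frac r s.
apply/eqP/frac_eqP; exists t => //.
by rewrite !mulNr -opprD mulrN e oppr0.
Qed.

Lemma loc_addE r s r' s' : loc_add (frac r s) (frac r' s')
  = frac (r * val s' + r' * val s) (denM s s').
Proof.
rewrite /loc_add; have [t tS e] := num_dnm_frac r s.
have [t' tS' e'] := num_dnm_frac r' s'.
apply/eqP/frac_eqP; exists (t * t'); first exact: rpredM.
move: e e'; rewrite /=; move: (num _) (dnm _) (num _) (dnm _) => a' b' a b e e'.
transitivity (t' * val s' * val b' * (t * (a * val s - r * val b))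
  + t * val s * val b * (t' * (a' * val s' - r' * val b'))); first by rewrite /=; ring.
by rewrite e e' !mulr0 addr0.
Qed.

Lemma loc_mulE r s r' s' :
  loc_mul (frac r s) (frac r' s') = frac (r * r') (denM s s').
Proof.
rewrite /loc_mul; have [t tS e] := num_dnm_frac r s.
have [t' tS' e'] := num_dnm_frac r' s'.
apply/eqP/frac_eqP; exists (t * t'); first exact: rpredM.
move: e e'; rewrite /=; move: (num _) (dnm _) (num _) (dnm _) => a' b' a b e e'.
transitivity (t' * a' * val s' * (t * (a * val s - r * val b))
  + t * r * val b * (t' * (a' * val s' - r' * val b'))); first by rewrite /=; ring.
by rewrite e e' !mulr0 addr0.
Qed.

Lemma frac_eq r s r' s' : r * val s' = r' * val s -> frac r s = frac r' s'.
Proof.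
by move=> e; apply/eqP/frac_eqP; exists 1; rewrite ?rpred1 // e subrr mulr0.
Qed.

Fact loc_addA : associative loc_add.
Proof.
elim/fracW => r s; elim/fracW => r' s'; elim/fracW => r'' s''.
by rewrite !loc_addE; apply: frac_eq => /=; ring.
Qed.

Fact loc_addC : commutative loc_add.
Proof.
elim/fracW => r s; elim/fracW => r' s'.
by rewrite !loc_addE; apply: frac_eq => /=; ring.
Qed.

Fact loc_add0 : left_id loc0 loc_add.
Proof. by elim/fracW => r s; rewrite loc_addE; apply: frac_eq => /=; ring. Qed.

Fact loc_addN : left_inverse loc0 loc_opp loc_add.
Proof.
by elim/fracW => r s; rewrite loc_oppE loc_addE; apply: frac_eq => /=; ring.
Qed.

HB.instance Definition _ :=
  GRing.isZmodule.Build loc loc_addA loc_addC loc_add0 loc_addN.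

Lemma fracN r s : - frac r s = frac (- r) s.
Proof. exact: loc_oppE. Qed.

Lemma fracD r s r' s' :
  frac r s + frac r' s' = frac (r * val s' + r' * val s) (denM s s').
Proof. exact: loc_addE. Qed.

Fact loc_mulA : associative loc_mul.
Proof.
elim/fracW => r s; elim/fracW => r' s'; elim/fracW => r'' s''.
by rewrite !loc_mulE; apply: frac_eq => /=; ring.
Qed.

Fact loc_mulC : commutative loc_mul.
Proof.
elim/fracW => r s; elim/fracW => r' s'.
by rewrite !loc_mulE; apply: frac_eq => /=; ring.
Qed.

Fact loc_mul1 : left_id loc1 loc_mul.
Proof. by elim/fracW => r s; rewrite loc_mulE; apply: frac_eq => /=; ring. Qed.

Fact loc_mulD : left_distributive loc_mul +%R.
Proof.
elim/fracW => r s; elim/fracW => r' s'; elim/fracW => r'' s''.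
by rewrite fracD !loc_mulE fracD; apply: frac_eq => /=; ring.
Qed.

HB.instance Definition _ :=
  GRing.Zmodule_isComPzRing.Build loc loc_mulA loc_mulC loc_mul1 loc_mulD.

Lemma fracM r s r' s' : frac r s * frac r' s' = frac (r * r') (denM s s').
Proof. exact: loc_mulE. Qed.

Definition to_loc (r : P) : loc := frac r den1.

Fact to_loc_is_zmod_morphism : zmod_morphism to_loc.
Proof.
by move=> r r'; rewrite /to_loc fracN fracD; apply: frac_eq => /=; ring.
Qed.

Fact to_loc_is_monoid_morphism : monoid_morphism to_loc.
Proof.
by split=> // r r'; rewrite /to_loc fracM; apply: frac_eq => /=; ring.
Qed.

HB.instance Definition _ :=
  GRing.isZmodMorphism.Build P loc to_loc to_loc_is_zmod_morphism.
HB.instance Definition _ :=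
  GRing.isMonoidMorphism.Build P loc to_loc to_loc_is_monoid_morphism.

Lemma to_locV s : to_loc (val s) * frac 1 s = 1.
Proof. by rewrite /to_loc fracM; apply: frac_eq => /=; ring. Qed.

Lemma fracE r s : frac r s = to_loc r * frac 1 s.
Proof. by rewrite /to_loc fracM; apply: frac_eq => /=; ring. Qed.

End Localization.

Definition derivation (A : pzRingType) (D : A -> A) : Prop :=
  {morph D : a b / a + b} /\ (forall a b, D (a * b) = D a * b + a * D b).

Lemma derivation_additive_gen (A : pzRingType) (D : A -> A) (T : Type)
    (u : T -> A) : {morph D : a b / a + b} ->
  (forall i j, D (u i * u j) = D (u i) * u j + u i * D (u j)) ->
  (forall a, exists s : seq T, a = \sum_(i <- s) u i) -> derivation D.
Proof.
move=> DD DM gen; split=> // a b.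
have D0 : D 0 = 0.
  have := DD 0 0; rewrite addr0 => /(congr1 (+%R^~ (- D 0))).
  by rewrite subrr addrK.
have [s ->] := gen a; have [s' ->] := gen b.
elim: s => [|i s IH]; first by rewrite !big_nil !mul0r D0 mul0r addr0.
rewrite !big_cons mulrDl !DD IH !mulrDl addrACA; congr (_ + _).
elim: s' {IH} => [|j s' IH]; first by rewrite !big_nil !mulr0 D0 mulr0 addr0.
by rewrite !big_cons mulrDr !DD IH DM !mulrDr addrACA.
Qed.

Section LocalizationDerivation.
Context (P : comNzRingType) (S : mulrClosed P) (D : P -> P).

(* The quotient rule; by [loc_der_frac] the value does not depend on the chosen
   representative as soon as [D] is a derivation. *)
Definition loc_der (a : loc S) : loc S :=
  frac (D (num a) * val (dnm a) - num a * D (val (dnm a)))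
       (denM (dnm a) (dnm a)).

Hypothesis derD : derivation D.

Lemma derivation0 : D 0 = 0.
Proof.
case: derD => DD _; have := DD 0 0; rewrite addr0 => /(congr1 (+%R^~ (- D 0))).
by rewrite subrr addrK.
Qed.

Lemma derivation1 : D 1 = 0.
Proof.
case: derD => _ DM; have := DM 1 1; rewrite !mulr1 mul1r.
by move/(congr1 (+%R^~ (- D 1))); rewrite subrr addrK.
Qed.

Lemma derivationN r : D (- r) = - D r.
Proof.
apply/eqP; rewrite -addr_eq0; case: derD => DD _.
by rewrite -DD addNr derivation0.
Qed.

Lemma loc_der_frac r s : loc_der (frac r s)
  = frac (D r * val s - r * D (val s)) (denM s s).
Proof.
rewrite /loc_der; have [t tS e] := num_dnm_frac r s; move: e.
move: (num _) (dnm _) => a b e; apply/eqP/frac_eqP.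
exists (t * t); first exact: rpredM.
case: derD => DD DM; have := congr1 D e.
rewrite !(DM, DD, derivationN) derivation0 => e' /=.
set u := a * val s - r * val b in e e'.
transitivity (t * val s * val b * (D t * u + t * (D a * val s + a * D (val s)
    - (D r * val b + r * D (val b))))
  - (val s * val b * D t + t * (val s * D (val b) + val b * D (val s)))
      * (t * u)); first by rewrite /u /=; ring.
by rewrite e e' !mulr0 subr0.
Qed.

Lemma loc_der_to_loc r : loc_der (to_loc S r) = to_loc S (D r).
Proof.
rewrite /to_loc loc_der_frac /= derivation1.
by apply: frac_eq => /=; ring.
Qed.

Lemma loc_der_derivation : derivation loc_der.
Proof.
case: derD => DD DM; split; elim/fracW => r s; elim/fracW => r' s'.
  rewrite fracD !loc_der_frac fracD /= !(DM, DD).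
  by apply: frac_eq => /=; ring.
rewrite fracM !loc_der_frac !fracM fracD /= !DM.
by apply: frac_eq => /=; ring.
Qed.

End LocalizationDerivation.

Section PolynomialsInVariables.
Context (I : choiceType) (R : comNzRingType).
Local Notation poly := (malg (cmonom I) R).

Definition pvar (i : I) : poly := mkmalgU (ucm i) 1.
Definition pconst (c : R) : poly := mkmalgU mone c.

Section Evaluation.
Context (v : I -> R).

Definition mon_eval (m : cmonom I) : R := \prod_(i <- finsupp m) v i ^+ m i.

Lemma mon_evalEw (d : {fset I}) (m : cmonom I) : (finsupp m `<=` d)%fset ->
  mon_eval m = \prod_(i <- d) v i ^+ m i.
Proof.
move=> le; rewrite /mon_eval (big_fset_incl _ le) // => i _.
by rewrite -cmE_eq0 => /eqP ->.
Qed.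

Fact mon_eval_mmorphism : mmorphism mon_eval.
Proof.
split; last by rewrite /mon_eval mdom1 big_seq_fset0.
move=> m1 m2; rewrite {1}/mon_eval mdomD.
rewrite (mon_evalEw (fsubsetUl _ (finsupp m2))).
rewrite (mon_evalEw (fsubsetUr (finsupp m1) _)) -big_split /=.
by apply: eq_bigr => i _; rewrite cmM exprD.
Qed.

HB.instance Definition _ :=
  isMultiplicative.Build (cmonom I) R mon_eval mon_eval_mmorphism.

Definition peval : poly -> R := mmap idfun mon_eval.

HB.instance Definition _ := GRing.RMorphism.copy peval (mmap idfun mon_eval).

Lemma peval_const c : peval (pconst c) = c.
Proof. exact: mmapC. Qed.

Lemma peval_var i : peval (pvar i) = v i.
Proof.
by rewrite /peval mmapU mul1r /mon_eval mdomU big_seq_fset1 cmUU expr1.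
Qed.

End Evaluation.

Section Derivation.
Context (delta : I -> poly).

Definition mon_der (m : cmonom I) : poly :=
  \sum_(i <- finsupp m) (mkmalgU (divcm m (ucm i)) (m i)%:R * delta i).

(* The R-linear derivation that maps the variable i to [delta i]. *)
Definition pder : poly -> poly := mmap pconst mon_der.

Lemma mon_derEw (d : {fset I}) (m : cmonom I) : (finsupp m `<=` d)%fset -> mon_der m =
  \sum_(i <- d) (mkmalgU (divcm m (ucm i)) (m i)%:R * delta i).
Proof.
move=> le; rewrite /mon_der (big_fset_incl _ le) // => i _.
by rewrite -cmE_eq0 => /eqP ->; rewrite monalgU0 mul0r.
Qed.

Lemma mkmalgUM (m m' : cmonom I) (c c' : R) :
  mkmalgU m c * mkmalgU m' c' = mkmalgU (mmul m m') (c * c').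
Proof. by rewrite malgM_def fgmulUU. Qed.

Lemma mon_derM m1 m2 : mon_der (mmul m1 m2) =
  mon_der m1 * mkmalgU m2 1 + mkmalgU m1 1 * mon_der m2.
Proof.
rewrite {1}/mon_der mdomD.
rewrite (mon_derEw (fsubsetUl _ (finsupp m2))).
rewrite (mon_derEw (fsubsetUr (finsupp m1) _)).
rewrite [X in _ = X + _]mulr_suml [X in _ = _ + X]mulr_sumr -big_split /=.
apply: eq_bigr => i _; rewrite cmM natrD monalgUD.
have -> : mkmalgU (divcm (mmul m1 m2) (ucm i)) (m1 i)%:R
    = mkmalgU (divcm m1 (ucm i)) (m1 i)%:R * mkmalgU m2 1 :> poly.
  have [->|m1i] := posnP (m1 i); first by rewrite !monalgU0 mul0r.
  rewrite mkmalgUM mulr1.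
  apply: (congr1 (fun m => mkmalgU m _)).
  apply/eqP/cmP => j; rewrite divcmE !cmM divcmE ucmE.
  by case: eqP => [<-|_]; [rewrite addnBAC | rewrite !subn0].
have -> : mkmalgU (divcm (mmul m1 m2) (ucm i)) (m2 i)%:R
    = mkmalgU m1 1 * mkmalgU (divcm m2 (ucm i)) (m2 i)%:R :> poly.
  have [->|m2i] := posnP (m2 i); first by rewrite !monalgU0 mulr0.
  rewrite mkmalgUM mul1r.
  apply: (congr1 (fun m => mkmalgU m _)).
  apply/eqP/cmP => j; rewrite divcmE !cmM divcmE ucmE.
  by case: eqP => [<-|_]; [rewrite addnBA | rewrite !subn0].
have aux (A : comNzRingType) (a b c d e : A) :
    (a * b + c * d) * e = a * e * b + c * (d * e) by ring.
exact: aux.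
Qed.

Lemma pderU m c : pder (mkmalgU m c) = pconst c * mon_der m.
Proof. by rewrite /pder (@mmapU _ _ _ (mkmalgU mone)). Qed.

Lemma pderD : {morph pder : a b / a + b}.
Proof. exact: (@mmapD _ _ _ (mkmalgU mone)). Qed.

Lemma pder0 : pder 0 = 0.
Proof. exact: (@mmap0 _ _ _ (mkmalgU mone)). Qed.

Lemma pderMU m1 c1 m2 c2 :
  pder (mkmalgU m1 c1 * mkmalgU m2 c2) =
  pder (mkmalgU m1 c1) * mkmalgU m2 c2 + mkmalgU m1 c1 * pder (mkmalgU m2 c2).
Proof.
have splitU m c : mkmalgU m c = pconst c * mkmalgU m 1 :> poly.
  by apply: esym; rewrite -[in RHS](mul1m m) -[in RHS](mulr1 c); exact: mkmalgUM.
have constM : pconst (c1 * c2) = pconst c1 * pconst c2 :> poly.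
  by rewrite /pconst -[in LHS](mul1m mone); apply: esym; exact: mkmalgUM.
transitivity (pconst (c1 * c2) * mon_der (mmul m1 m2)).
  exact: etrans (congr1 pder (mkmalgUM m1 m2 c1 c2)) (pderU _ _).
transitivity (pconst c1 * mon_der m1 * (pconst c2 * mkmalgU m2 1)
    + pconst c1 * mkmalgU m1 1 * (pconst c2 * mon_der m2)); last first.
  have {}splitU m c := esym (splitU m c); have pU m c := esym (pderU m c).
  exact: (congr2 +%R (congr2 *%R (pU m1 c1) (splitU m2 c2))
                     (congr2 *%R (splitU m1 c1) (pU m2 c2))).
rewrite mon_derM constM.
have aux (A : comNzRingType) (a b d1 d2 e1 e2 : A) :
    a * b * (d1 * e2 + e1 * d2) = a * d1 * (b * e2) + a * e1 * (b * d2) by ring.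
exact: aux.
Qed.

Lemma pder_derivation : derivation pder.
Proof.
apply: (@derivation_additive_gen _ _ _ (fun mc => mkmalgU mc.1 mc.2)).
- exact: pderD.
- by move=> mc mc'; exact: pderMU.
- move=> a; exists [seq (m, mcoeff m a) | m <- msupp a].
  by rewrite big_map; exact: monalgE.
Qed.

Lemma pder_const c : pder (pconst c) = 0.
Proof. by rewrite pderU /mon_der mdom1 big_seq_fset0 mulr0. Qed.

Lemma pder_var i : pder (pvar i) = delta i.
Proof.
rewrite pderU /mon_der mdomU big_seq_fset1 cmUU.
suff -> : divcm (ucm i) (ucm i) = mone by rewrite !mul1r.
by apply/eqP/cmP => j; rewrite divcmE subnn cm1.
Qed.

End Derivation.
End PolynomialsInVariables.

Section DifferentialIdeals.
Context (A : comPzRingType) (Ds : set (A -> A)).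

(* Differential ideals need not be proper, unlike mathcomp's [idealr]. *)
Definition diff_ideal (J : set A) : Prop :=
  [/\ J 0, (forall a b, J a -> J b -> J (a + b)),
      (forall a b, J b -> J (a * b)) & (forall D, Ds D -> forall a, J a -> J (D a))].

Definition diff_ideal_gen (G : set A) : set A := smallest diff_ideal G.

End DifferentialIdeals.

Inductive jet_var := JX | JY | JD of nat & nat.

Definition jet_var_encode v : option (option (nat * nat)) :=
  match v with
  | JX => None
  | JY => Some None
  | JD i j => Some (Some (i, j))
  end.

Definition jet_var_decode (o : option (option (nat * nat))) : jet_var :=
  match o with
  | None => JX
  | Some None => JY
  | Some (Some (i, j)) => JD i j
  end.

Fact jet_var_encodeK : cancel jet_var_encode jet_var_decode.
Proof. by case. Qed.

HB.instance Definition _ := Choice.copy jet_var (can_type jet_var_encodeK).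

Notation jet_poly R := (malg (cmonom jet_var) R).

Section JetRing.
Context (R : comNzRingType).

Definition jx : jet_poly R := pvar R JX.
Definition jy : jet_poly R := pvar R JY.
Definition jd (i j : nat) : jet_poly R := pvar R (JD i j).

Definition jet_hess : jet_poly R := jd 0 2 * jd 2 0 - jd 1 1 ^+ 2.

Definition jet_S : mulrClosed (jet_poly R) :=
  GRing.MulClosed.clone _ (in_submonoid [set jd 0 2; jd 2 0; jet_hess]) _.

Definition jet_loc : comPzRingType := loc jet_S.

Definition jet_delta_x (v : jet_var) : jet_poly R :=
  match v with JX => 1 | JY => 0 | JD i j => jd i.+1 j end.

Definition jet_delta_y (v : jet_var) : jet_poly R :=
  match v with JX => 0 | JY => 1 | JD i j => jd i j.+1 end.

Definition jet_Dx : jet_loc -> jet_loc := @loc_der _ jet_S (pder jet_delta_x).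
Definition jet_Dy : jet_loc -> jet_loc := @loc_der _ jet_S (pder jet_delta_y).

Lemma jet_Dx_derivation : derivation jet_Dx.
Proof. exact/loc_der_derivation/pder_derivation. Qed.

Lemma jet_Dy_derivation : derivation jet_Dy.
Proof. exact/loc_der_derivation/pder_derivation. Qed.

Lemma jet_Dx_const c : jet_Dx (to_loc jet_S (pconst jet_var c)) = 0.
Proof.
rewrite /jet_Dx loc_der_to_loc ?pder_const ?rmorph0 //; exact: pder_derivation.
Qed.

Lemma jet_Dy_const c : jet_Dy (to_loc jet_S (pconst jet_var c)) = 0.
Proof.
rewrite /jet_Dy loc_der_to_loc ?pder_const ?rmorph0 //; exact: pder_derivation.
Qed.

Lemma jet_Dx_var v :
  jet_Dx (to_loc jet_S (pvar R v)) = to_loc jet_S (jet_delta_x v).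
Proof.
rewrite /jet_Dx loc_der_to_loc ?pder_var //; exact: pder_derivation.
Qed.

Lemma jet_Dy_var v :
  jet_Dy (to_loc jet_S (pvar R v)) = to_loc jet_S (jet_delta_y v).
Proof.
rewrite /jet_Dy loc_der_to_loc ?pder_var //; exact: pder_derivation.
Qed.

End JetRing.

Section DifferentialOperators.
Context (R : realType).
Implicit Types (Omega : set (R * R)) (f : R * R -> R) (p : R * R).

Definition partial_x f : R * R -> R := 'D_((1 : R), (0 : R)) f.
Definition partial_y f : R * R -> R := 'D_((0 : R), (1 : R)) f.

Definition partial (i j : nat) f : R * R -> R :=
  iter i partial_x (iter j partial_y f).

(* A function Omega -> R is represented by an arbitrary extension to the plane:
   Omega being open, only its values on Omega matter below. *)

Definition partials (w : seq bool) f : R * R -> R :=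
  foldr (fun b => if b then partial_x else partial_y) f w.

Definition smooth_on Omega f : Prop := forall w p, Omega p ->
  [/\ {for p, continuous (partials w f)},
      derivable (partials w f) p ((1 : R), (0 : R)) &
      derivable (partials w f) p ((0 : R), (1 : R))].

Definition generic Omega f : Prop :=
  smooth_on Omega f /\ forall p, Omega p ->
    [/\ partial 0 2 f p != 0, partial 2 0 f p != 0 &
        partial 0 2 f p * partial 2 0 f p - partial 1 1 f p ^+ 2 != 0].

Definition quadric Omega f : Prop :=
  generic Omega f /\
  exists a11 a12 a13 a22 a23 a33 b1 b2 b3 c : R,
    [|| a11 != 0, a12 != 0, a13 != 0, a22 != 0, a23 != 0, a33 != 0,
        b1 != 0, b2 != 0, b3 != 0 | c != 0] /\
    forall x y, Omega (x, y) -> let z := f (x, y) in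
      a11 * x ^+ 2 + a12 * x * y + a13 * x * z + a22 * y ^+ 2 + a23 * y * z
      + a33 * z ^+ 2 + b1 * x + b2 * y + b3 * z + c = 0.

Definition jet_val f p (v : jet_var) : R :=
  match v with JX => p.1 | JY => p.2 | JD i j => partial i j f p end.

Definition jet_eval f p : jet_poly R -> R := peval (jet_val f p).

HB.instance Definition _ f p :=
  GRing.RMorphism.copy (jet_eval f p) (peval (jet_val f p)).

Lemma jet_eval_d f p i j : jet_eval f p (jd R i j) = partial i j f p.
Proof. exact: peval_var. Qed.

Lemma jet_eval_hess f p : jet_eval f p (jet_hess R)
  = partial 0 2 f p * partial 2 0 f p - partial 1 1 f p ^+ 2.
Proof.
have aux (A : comNzRingType) (phi : {rmorphism A -> R}) a b c :
    phi (a * b - c ^+ 2) = phi a * phi b - phi c ^+ 2.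
  by rewrite rmorphB rmorphXn rmorphM.
apply: (etrans (aux _ (jet_eval f p) _ _ _)).
exact: (congr2 (fun u v => u - v)
  (congr2 *%R (jet_eval_d f p 0 2) (jet_eval_d f p 2 0))
  (congr1 (fun u => u ^+ 2) (jet_eval_d f p 1 1))).
Qed.

(* The value (T f)(p); see [jet_act_frac] for the independence of the chosen
   representative of T. *)
Definition jet_act (T : jet_loc R) f p : R :=
  jet_eval f p (num T) / jet_eval f p (val (dnm T)).

Lemma jet_eval_S_neq0 Omega f p s :
  generic Omega f -> Omega p -> s \in jet_S R -> jet_eval f p s != 0.
Proof.
move=> [_ gen] Op /asboolP/(_ [set r | jet_eval f p r != 0]) H.
apply: H; split; first split=> /=.
- by rewrite rmorph1 oner_eq0.
- by move=> a b a0 b0; rewrite rmorphM mulf_neq0.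
have [n02 n20 nH] := gen p Op; move=> r /= [[|]|] ->.
- by move: n02; rewrite -(jet_eval_d f p 0 2).
- by move: n20; rewrite -(jet_eval_d f p 2 0).
- by move: nH; rewrite -(jet_eval_hess f p).
Qed.

Lemma jet_act_frac Omega f p r s : generic Omega f -> Omega p ->
  jet_act (frac r s) f p = jet_eval f p r / jet_eval f p (val s).
Proof.
move=> gen Op; have [t tS e] := num_dnm_frac r s.
have n0 := jet_eval_S_neq0 gen Op.
rewrite /jet_act; apply/eqP; rewrite eqr_div ?n0 //; try exact: valP.
have aux (A : comNzRingType) (phi : {rmorphism A -> R}) t0 a b c d :
    t0 * (a * b - c * d) = 0 -> phi t0 != 0 -> phi a * phi b == phi c * phi d.
  move=> /(congr1 phi); rewrite rmorph0 rmorphM rmorphB !rmorphM => /eqP.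
  by rewrite mulf_eq0 subr_eq0 => /orP[->|].
exact: (aux _ (jet_eval f p) _ _ _ _ _ e (n0 _ tS)).
Qed.

Definition annihilator Omega (X : set (R * R -> R)) : set (jet_loc R) :=
  [set T | forall f, X f -> forall p, Omega p -> jet_act T f p = 0].

Definition quadric_gen1 : jet_loc R := to_loc (jet_S R) (
  jd R 3 0 * jd R 0 2 ^+ 2 - 3 * jd R 1 2 * jd R 2 0 * jd R 0 2
  + 2 * jd R 0 3 * jd R 1 1 * jd R 2 0).

Definition quadric_gen2 : jet_loc R := to_loc (jet_S R) (
  jd R 0 3 * jd R 2 0 ^+ 2 - 3 * jd R 2 1 * jd R 0 2 * jd R 2 0
  + 2 * jd R 3 0 * jd R 1 1 * jd R 0 2).

End DifferentialOperators.

(* Main.v *)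
From HB Require Import structures.
From mathcomp Require Import all_boot all_order all_algebra ring lra finmap.
From mathcomp Require Import boolp classical_sets reals topology normedtype.
From mathcomp Require Import derive realfun.
From mathcomp Require monalg.
Import -(notations) monalg.
Require Import Defs.
Import Order.TTheory GRing.Theory Num.Theory numFieldNormedType.Exports.

(** One inclusion is a computation.  For a smooth generic [f] the operators that
    annihilate [f] form a differential ideal: evaluation at the jet of [f] turns
    the formal derivations into partial derivatives, provided the second
    derivatives commute ([derive_commute]).  So it suffices that both generators
    annihilate every quadric.  Write the equation of the quadric as
    [F (x, y, z) = 0].  Differentiating [F (x, y, f) = 0] three times expresses
    [F_z f_xxx], [F_z f_xxy], [F_z f_xyy], [F_z f_yyy] by lower jets, and both
    equations follow after multiplication by [F_z]; and [F_z] has no zero on the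
    graph, since a zero together with [f_xx], [f_yy] nonzero forces all
    coefficients of [F] to vanish ([vertical_derivative_neq0]).

    For the other inclusion one counts parameters.  Write [uij] for the jet of
    order [i] in [x] and [j] in [y].  Modulo the differential ideal [I]
    generated by the two equations, every element of the localization is,
    up to a factor in [S], a polynomial in [x], [y], the jets of order at most 2,
    and [u30], [u03], [u40] ([all_normal_form]).  The two equations
    give [u21] and [u12].  Their first derivatives are four linear equations in
    the jets of order 4, solvable in terms of [u40] because
    [u20], [u02] and the Hessian are invertible ([order4]).  Their second
    derivatives are six linear equations in the six jets of order 5, and they
    determine all of them; [order5] finds [u50] and [u41], which is what is needed
    to express the derivatives of the parameters.

    Conversely these eleven parameters are independent on quadrics.  The ovals
    [f = l + sqrt q], with [l] affine and [q] a quadratic polynomial whose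
    homogenization is positive definite, are generic on the whole plane, so
    they serve for every [Omega], and their jets at a point fill an open set of
    parameter values ([oval_with_jet]).  If [T] annihilates all quadrics,
    so does its polynomial normal form, which therefore vanishes on an open box
    and is zero ([peval_eq0_on_infinite_box]).  Hence [s * T] is in [I] for some
    [s] in [S], and [s] is a unit. *)

Set Implicit Arguments.
Unset Strict Implicit.
Unset Printing Implicit Defensive.

Local Open Scope classical_set_scope.
Local Open Scope ring_scope.

(** * Elimination of jets modulo the two equations *)

Section DerivationRules.
Context (A : pzRingType) (D : A -> A).
Hypothesis derD : derivation D.

Lemma derivationD : {morph D : a b / a + b}. Proof. by case: derD. Qed.

Lemma derivationM a b : D (a * b) = D a * b + a * D b.
Proof. by case: derD. Qed.

Lemma pz_derivation0 : D 0 = 0.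
Proof. by apply: (addrI (D 0)); rewrite -derivationD !addr0. Qed.

Lemma derivationB : {morph D : a b / a - b}.
Proof.
by move=> a b; apply: (addIr (D b)); rewrite -derivationD !subrK.
Qed.

Lemma derivation_nat n : D n%:R = 0.
Proof.
elim: n => [|n IH]; first exact: pz_derivation0.
rewrite -natr1 derivationD IH add0r.
by apply: (addrI (D 1)); rewrite -[in RHS](mulr1 1) derivationM mulr1 mul1r addr0.
Qed.

End DerivationRules.

(** [N] stands for the elements that reduce to the chosen parameters modulo the
    differential ideal [I]: a subring containing [I], from which the units can be
    cancelled.  The jets are abstracted to a family [u] shifted by [Dx], [Dy]. *)
Section JetElimination.
Context (A : comPzRingType) (Dx Dy : A -> A) (u : nat -> nat -> A).
Hypotheses (derDx : derivation Dx) (derDy : derivation Dy).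
Hypotheses (Dxu : forall i j, Dx (u i j) = u i.+1 j)
           (Dyu : forall i j, Dy (u i j) = u i j.+1).
Context (I N : set A).
Hypotheses (IDx : forall a, I a -> I (Dx a)) (IDy : forall a, I a -> I (Dy a)).
Hypotheses (ND : forall a b, N a -> N b -> N (a + b))
           (NN : forall a, N a -> N (- a))
           (NM : forall a b, N a -> N b -> N (a * b))
           (Nnat : forall n, N n%:R) (IN : forall a, I a -> N a).

Local Notation r := (u 2 0).
Local Notation s := (u 1 1).
Local Notation t := (u 0 2).
Local Notation h := (t * r - s ^+ 2).

Hypothesis N_low : forall i j, (i + j <= 2)%N -> N (u i j).
Hypotheses (N30 : N (u 3 0)) (N03 : N (u 0 3)) (N40 : N (u 4 0)).
Hypotheses (rK : forall a, N (r * a) -> N a) (tK : forall a, N (t * a) -> N a)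
           (hK : forall a, N (h * a) -> N a)
           (natK : forall n a, N (n.+1%:R * a) -> N a).
Hypotheses
  (G1 : I (u 3 0 * t ^+ 2 - 3 * u 1 2 * r * t + 2 * u 0 3 * s * r))
  (G2 : I (u 0 3 * r ^+ 2 - 3 * u 2 1 * t * r + 2 * u 3 0 * s * t)).

Let Nr : N r := @N_low 2 0 isT.
Let Ns : N s := @N_low 1 1 isT.
Let Nt : N t := @N_low 0 2 isT.
Let NX a n : N a -> N (a ^+ n).
Proof.
by move=> Na; elim: n => [|n IH]; rewrite ?expr0 ?exprS; [exact: (Nnat 1)|exact: NM].
Qed.
Let NB a b : N a -> N b -> N (a - b).
Proof. by move=> Na Nb; apply: ND => //; apply: NN. Qed.

Ltac nclosed := repeat first
  [ assumption | exact: Nnat | apply: ND | apply: NN | apply: NX | apply: NM ].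

Lemma third_order : N (u 1 2) /\ N (u 2 1).
Proof.
split.
- apply/(@natK 2)/rK/tK.
  have /IN H := G1.
  have -> : t * (r * (3 * u 1 2)) =
    u 3 0 * t ^+ 2 + 2 * u 0 3 * s * r -
    (u 3 0 * t ^+ 2 - 3 * u 1 2 * r * t + 2 * u 0 3 * s * r) by ring.
  by nclosed.
- apply/(@natK 2)/rK/tK.
  have /IN H := G2.
  have -> : t * (r * (3 * u 2 1)) =
    u 0 3 * r ^+ 2 + 2 * u 3 0 * s * t -
    (u 0 3 * r ^+ 2 - 3 * u 2 1 * t * r + 2 * u 3 0 * s * t) by ring.
  by nclosed.
Qed.

(** The hypotheses are the quartic forms [X G1, Y G1, X G2, Y G2], where
    [G1 = t^2 X^3 - 3 r t X Y^2 + 2 s r Y^3] and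
    [G2 = r^2 Y^3 - 3 r t X^2 Y + 2 s t X^3] are the leading forms of the two
    equations, with the monomial [X^(4-i) Y^i] replaced by [e_i].  Being linear,
    the relations serve for the jets of order 4, and for those of order 5
    when [e] is shifted by one more [X] or [Y]. *)
Lemma quartic_elim e0 e1 e2 e3 e4 :
  N (t ^+ 2 * e0 - 3 * r * t * e2 + 2 * s * r * e3) ->
  N (t ^+ 2 * e1 - 3 * r * t * e3 + 2 * s * r * e4) ->
  N (r ^+ 2 * e3 - 3 * r * t * e1 + 2 * s * t * e0) ->
  N (r ^+ 2 * e4 - 3 * r * t * e2 + 2 * s * t * e1) ->
  N (r * e1 - s * e0) /\ N (3 * r ^+ 2 * e2 - (r * t + 2 * s ^+ 2) * e0).
Proof.
move=> H4 H2 H1 H3.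
have Ha : N (r * e1 - s * e0).
  apply/(@natK 7)/tK/hK.
  (* In this combination e2, e3 and e4 cancel. *)
  suff -> : h * (t * (8 * (r * e1 - s * e0))) =
     2 * s * r * (r ^+ 2 * e4 - 3 * r * t * e2 + 2 * s * t * e1)
     - r ^+ 2 * (t ^+ 2 * e1 - 3 * r * t * e3 + 2 * s * r * e4)
     - 3 * r * t * (r ^+ 2 * e3 - 3 * r * t * e1 + 2 * s * t * e0)
     - 2 * s * r * (t ^+ 2 * e0 - 3 * r * t * e2 + 2 * s * r * e3)
     + 4 * s ^+ 2 * (r ^+ 2 * e3 - 3 * r * t * e1 + 2 * s * t * e0).
    by nclosed.
  by ring.
split=> //; apply: tK.
suff -> : t * (3 * r ^+ 2 * e2 - (r * t + 2 * s ^+ 2) * e0) =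
   6 * s * t * (r * e1 - s * e0)
   - (r * (t ^+ 2 * e0 - 3 * r * t * e2 + 2 * s * r * e3)
      - 2 * s * (r ^+ 2 * e3 - 3 * r * t * e1 + 2 * s * t * e0)).
  by nclosed.
by ring.
Qed.

(** A differential equation and its derivatives are linear in their jets of highest
    order only up to terms of lower order.  The condition that all derivatives of
    order at most [k] lie in [N] is stable under ring operations, so it discards
    those terms without expanding them. *)
Fixpoint derivs_in k a :=
  N a /\ if k is k'.+1 then derivs_in k' (Dx a) /\ derivs_in k' (Dy a) else True.

Lemma derivs_inW k a : derivs_in k.+1 a -> derivs_in k a.
Proof.
elim: k a => [|k IH] a; first by case.
by case=> Na [/IH ? /IH ?].
Qed.

Lemma derivs_in0 k a : derivs_in k a -> N a. Proof. by case: k => [|k] []. Qed.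

Lemma derivs_inD k a b : derivs_in k a -> derivs_in k b -> derivs_in k (a + b).
Proof.
elim: k a b => [|k IH] a b; first by move=> [Na _] [Nb _]; split=> //; exact: ND.
move=> [Na [ax ay]] [Nb [bx b_y]]; split; first exact: ND.
by rewrite (derivationD derDx) (derivationD derDy); split; apply: IH.
Qed.

Lemma derivs_inM k a b : derivs_in k a -> derivs_in k b -> derivs_in k (a * b).
Proof.
elim: k a b => [|k IH] a b; first by move=> [Na _] [Nb _]; split=> //; exact: NM.
move=> aS bS; have /derivs_inW ak := aS; have /derivs_inW bk := bS.
case: aS bS => Na [ax ay] [Nb [bx b_y]]; split; first exact: NM.
rewrite (derivationM derDx) (derivationM derDy).
by split; apply: derivs_inD; apply: IH.
Qed.

Lemma derivs_in_nat k n : derivs_in k n%:R.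
Proof.
elim: k n => [|k IH] n; split=> //.
rewrite (derivation_nat derDx) (derivation_nat derDy); split; exact: (IH 0).
Qed.

Lemma derivs_in_u m k i j : (forall i j, (i + j <= m)%N -> N (u i j)) ->
  (i + j + k <= m)%N -> derivs_in k (u i j).
Proof.
move=> Nu; elim: k i j => [|k IH] i j le.
  by split=> //; apply: Nu; rewrite addn0 in le.
split; first by apply: Nu; apply: leq_trans le; rewrite leq_addr.
rewrite Dxu Dyu; split; apply: IH; first by rewrite !addSn -addnS.
by rewrite addnS addSn -addnS.
Qed.

Let is_der D := D = Dx \/ D = Dy.

Let is_der_derivation D : is_der D -> derivation D.
Proof. by case=> ->. Qed.

Lemma derivs_in_der k a D : is_der D -> derivs_in k.+1 a -> derivs_in k (D a).
Proof. by case=> -> [_ []]. Qed.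

Lemma leading1 D a v : is_der D -> derivs_in 1 a -> N v -> N (D (a * v) - a * D v).
Proof.
move=> iD aN Nv; rewrite (derivationM (is_der_derivation iD)) addrK.
by apply: NM => //; have /derivs_in0 := derivs_in_der iD aN.
Qed.

Lemma leading2 D D' a v : is_der D -> is_der D' ->
  derivs_in 2 a -> derivs_in 1 v -> N (D (D' (a * v)) - a * D (D' v)).
Proof.
move=> iD iD' aN vN; have /derivationM DM := is_der_derivation iD.
rewrite (derivationM (is_der_derivation iD')).
rewrite (derivationD (is_der_derivation iD)) !DM !addrA addrK.
have aD' := derivs_in_der iD' aN; have /derivs_in0 aDD := derivs_in_der iD aD'.
have /derivs_in0 aD := derivs_in_der iD aN.
have /derivs_in0 vD := derivs_in_der iD vN.
have /derivs_in0 vD' := derivs_in_der iD' vN.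
by move: (derivs_in0 aD') (derivs_in0 aN) (derivs_in0 vN) => *; nclosed.
Qed.

(** [F] is a derivation or a product of two; the hypotheses are those that
    [leading1] and [leading2] provide. *)
Lemma leading_comb (F : A -> A) a b c v1 v2 v3 : {morph F : x y / x + y} ->
  N (F (a * v1) - a * F v1) -> N (F (b * v2) - b * F v2) ->
  N (F (c * v3) - c * F v3) -> N (F (a * v1 + b * v2 + c * v3)) ->
  N (a * F v1 + b * F v2 + c * F v3).
Proof.
move=> FD Ha Hb Hc; rewrite !FD => H.
have -> : a * F v1 + b * F v2 + c * F v3 = F (a * v1) + F (b * v2) + F (c * v3)
  - (F (a * v1) - a * F v1) - (F (b * v2) - b * F v2) - (F (c * v3) - c * F v3).
  by ring.
by nclosed.
Qed.

Lemma G1_leading : I (t ^+ 2 * u 3 0 + (- 3%:R * r * t) * u 1 2 + (2 * s * r) * u 0 3).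
Proof. by have := G1; congr I; ring. Qed.

Lemma G2_leading : I (r ^+ 2 * u 0 3 + (- 3%:R * r * t) * u 2 1 + (2 * s * t) * u 3 0).
Proof. by have := G2; congr I; ring. Qed.

Let low_coefs k m : (forall i j, (i + j <= m)%N -> N (u i j)) -> (2 + k <= m)%N ->
  [/\ derivs_in k (t ^+ 2), derivs_in k (r ^+ 2), derivs_in k (- 3%:R * r * t),
      derivs_in k (2 * s * r) & derivs_in k (2 * s * t)].
Proof.
move=> Nu le.
have kr : derivs_in k r by apply: derivs_in_u Nu _.
have ks : derivs_in k s by apply: derivs_in_u Nu _.
have kt : derivs_in k t by apply: derivs_in_u Nu _.
have k3 : derivs_in k (- 3%:R).
  elim: k {le kr ks kt} => [|k IH]; first by split=> //; exact: NN.
  split; first exact: NN.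
  have D3 D : derivation D -> D (- 3%:R) = 0.
    by move=> dD; rewrite -[- _]add0r (derivationB dD) (pz_derivation0 dD)
      (derivation_nat dD) subr0.
  by rewrite !D3 //; split; exact: (derivs_in_nat k 0).
have k2 := derivs_in_nat k 2.
by rewrite !expr2; split; repeat apply: derivs_inM.
Qed.

Lemma order3 i j : (i + j <= 3)%N -> N (u i j).
Proof.
have [N12 N21] := third_order; rewrite leq_eqVlt => /orP[/eqP e|]; last exact: N_low.
have -> : j = (3 - i)%N by rewrite -e addKn.
have : (i <= 3)%N by rewrite -e leq_addr.
by case: i {e} => [|[|[|[|i]]]].
Qed.

(** [quartic_elim] at order 4, where [e0 = u 4 0] is a parameter. *)
Lemma order4 i j : (i + j <= 4)%N -> N (u i j).
Proof.
have [t2 r2 rt sr st] := low_coefs order3 (leqnn 3).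
have L1 D : is_der D -> N (t ^+ 2 * D (u 3 0) + (- 3%:R * r * t) * D (u 1 2)
    + (2 * s * r) * D (u 0 3)).
  move=> iD; apply: leading_comb; [exact: derivationD (is_der_derivation iD) | | | |];
  [by apply: leading1 => //; apply: order3 ..|].
  by apply: IN; case: iD => ->; [apply: IDx|apply: IDy]; exact: G1_leading.
have L2 D : is_der D -> N (r ^+ 2 * D (u 0 3) + (- 3%:R * r * t) * D (u 2 1)
    + (2 * s * t) * D (u 3 0)).
  move=> iD; apply: leading_comb; [exact: derivationD (is_der_derivation iD) | | | |];
  [by apply: leading1 => //; apply: order3 ..|].
  by apply: IN; case: iD => ->; [apply: IDx|apply: IDy]; exact: G2_leading.
have H4 := L1 Dx (or_introl erefl); have H2 := L1 Dy (or_intror erefl).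
have H1 := L2 Dx (or_introl erefl); have H3 := L2 Dy (or_intror erefl).
rewrite !(Dxu, Dyu) !mulNr in H4 H2 H1 H3.
have [Ha Hb] := quartic_elim H4 H2 H1 H3.
have N31 : N (u 3 1).
  by apply: rK; rewrite -(subrK (s * u 4 0) (r * _)); nclosed.
have N22 : N (u 2 2).
  apply/rK/rK/(@natK 2).
  have -> : 3 * (r * (r * u 2 2)) = (3 * r ^+ 2 * u 2 2 -
    (r * t + 2 * s ^+ 2) * u 4 0) + (r * t + 2 * s ^+ 2) * u 4 0 by ring.
  by nclosed.
have N13 : N (u 1 3).
  apply/rK/rK.
  have -> : r * (r * u 1 3) = (r ^+ 2 * u 1 3 - 3 * r * t * u 3 1 + 2 * s * t * u 4 0)
    + 3 * r * t * u 3 1 - 2 * s * t * u 4 0 by ring.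
  by nclosed.
have N04 : N (u 0 4).
  apply/rK/rK.
  have -> : r * (r * u 0 4) = (r ^+ 2 * u 0 4 - 3 * r * t * u 2 2 + 2 * s * t * u 3 1)
    + 3 * r * t * u 2 2 - 2 * s * t * u 3 1 by ring.
  by nclosed.
rewrite leq_eqVlt => /orP[/eqP e|]; last exact: order3.
have -> : j = (4 - i)%N by rewrite -e addKn.
have : (i <= 4)%N by rewrite -e leq_addr.
by case: i {e} => [|[|[|[|[|i]]]]].
Qed.

(** With [e0, e1, e2] for [u 5 0], [u 4 1], [u 3 2] and equalities up to elements of
    [N]: the [X]-shift of [quartic_elim] gives [r e1 = s e0] and
    [3 r^2 e2 = (r t + 2 s^2) e0], and the [Y]-shift gives [r e2 = s e1], so that
    [r^2 e2 = s^2 e0].  Together, [h e0 = 0], and [h] can be cancelled. *)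
Lemma order5 : N (u 5 0) /\ N (u 4 1).
Proof.
have [t2 r2 rt sr st] := low_coefs order4 (leqnn 4).
have u3 i j : (i + j + 1 <= 4)%N -> derivs_in 1 (u i j).
  exact: (derivs_in_u order4).
have L1 D D' : is_der D -> is_der D' -> N (t ^+ 2 * D (D' (u 3 0))
    + (- 3%:R * r * t) * D (D' (u 1 2)) + (2 * s * r) * D (D' (u 0 3))).
  move=> iD iD'; apply: (@leading_comb (D \o D')) => /=.
  - move=> a b /=; rewrite (derivationD (is_der_derivation iD')).
    exact: derivationD (is_der_derivation iD) _ _.
  - exact: (leading2 iD iD' t2 (u3 3 0 isT)).
  - exact: (leading2 iD iD' rt (u3 1 2 isT)).
  - exact: (leading2 iD iD' sr (u3 0 3 isT)).
  - by apply: IN; case: iD => ->; case: iD' => ->;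
      repeat first [exact: G1_leading | apply: IDx | apply: IDy].
have L2 D D' : is_der D -> is_der D' -> N (r ^+ 2 * D (D' (u 0 3))
    + (- 3%:R * r * t) * D (D' (u 2 1)) + (2 * s * t) * D (D' (u 3 0))).
  move=> iD iD'; apply: (@leading_comb (D \o D')) => /=.
  - move=> a b /=; rewrite (derivationD (is_der_derivation iD')).
    exact: derivationD (is_der_derivation iD) _ _.
  - exact: (leading2 iD iD' r2 (u3 0 3 isT)).
  - exact: (leading2 iD iD' rt (u3 2 1 isT)).
  - exact: (leading2 iD iD' st (u3 3 0 isT)).
  - by apply: IN; case: iD => ->; case: iD' => ->;
      repeat first [exact: G2_leading | apply: IDx | apply: IDy].
have ix : is_der Dx by left. have iy : is_der Dy by right.
have A1 := L1 _ _ ix ix; have A2 := L1 _ _ ix iy; have A3 := L1 _ _ iy iy.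
have B1 := L2 _ _ ix ix; have B2 := L2 _ _ ix iy; have B3 := L2 _ _ iy iy.
rewrite !(Dxu, Dyu) !mulNr in A1 A2 A3 B1 B2 B3.
have [X1 X2] := quartic_elim A1 A2 B1 B2.
have [Y1 _] := quartic_elim A2 A3 B2 B3.
have N50 : N (u 5 0).
  apply: hK.
  have -> : h * u 5 0 = 3 * r * (r * u 3 2 - s * u 4 1) + 3 * s * (r * u 4 1 - s * u 5 0)
   - (3 * r ^+ 2 * u 3 2 - (r * t + 2 * s ^+ 2) * u 5 0) by ring.
  by nclosed.
split=> //.
by apply: rK; rewrite -(subrK (s * u 5 0) (r * _)); nclosed.
Qed.

End JetElimination.

(** * Polynomials in arbitrarily many variables *)

Section PolynomialVanishing.
Context (I : choiceType) (R : idomainType) (U : I -> R -> Prop).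
Hypothesis U_infinite : forall i n, exists s : seq R,
  [/\ uniq s, size s = n & forall x, x \in s -> U i x].

(** Induction on the variables: for fixed values of the others, the sum is a
    polynomial in the variable [i] with infinitely many roots, so each of its
    coefficients vanishes, and these are sums of the same kind over the
    monomials with a given exponent at [i].  The injectivity condition lets the
    variables already treated be dropped from the product. *)
Lemma monomials_free (c : cmonom I -> R) (d : seq I) (M : seq (cmonom I)) :
    uniq d -> uniq M ->
    (forall m m', m \in M -> m' \in M -> {in d, m =1 m'} -> m = m') ->
    (forall v, (forall i, U i (v i)) ->
      \sum_(m <- M) c m * \prod_(i <- d) v i ^+ m i = 0) ->
  forall m, m \in M -> c m = 0.
Proof.
elim: d M => [|i d IH] M.
  move=> _ uM inj vanish m0 m0M.
  have v0 : exists v : I -> R, forall i, U i (v i).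
    have : forall i, exists x, U i x; last by move=> /choice[v vU]; exists v.
    move=> i; have [[|x s] [_ // _ sU]] := U_infinite i 1.
    by exists x; apply: sU; rewrite mem_head.
  have [v vU] := v0; have := vanish v vU.
  rewrite (eq_bigr c) => [|m _]; last by rewrite big_nil mulr1.
  rewrite (bigD1_seq m0) //= big_seq_cond big1 ?addr0 // => m /andP[mM].
  by rewrite (inj m m0 mM m0M) ?eqxx.
rewrite cons_uniq => /andP[id ud] uM inj vanish m0 m0M.
pose M' := [seq m : cmonom I <- M | m i == m0 i].
apply: (IH M'); rewrite ?filter_uniq ?mem_filter ?eqxx //.
  move=> m m'; rewrite !mem_filter => /andP[/eqP e mM] /andP[/eqP e' m'M] eqd.
  apply: inj => // j; rewrite inE => /orP[/eqP ->|]; last exact: eqd.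
  by rewrite e e'.
move=> v vU.
pose p := \sum_(m <- M) (c m * \prod_(j <- d) v j ^+ m j) *: 'X^(m i).
have p_root x : U i x -> root p x.
  move=> xU; pose v' j := if j == i then x else v j.
  have vU' j : U j (v' j) by rewrite /v'; case: eqP => [->|].
  apply/eqP; rewrite -[RHS](vanish v' vU') /p horner_sum.
  apply: eq_bigr => m _; rewrite hornerZ hornerXn big_cons -mulrA.
  congr (_ * _); rewrite /v' eqxx mulrC; congr (_ * _).
  apply: eq_big_seq => j jd; case: eqP => // ji.
  by move: id; rewrite -ji jd.
have p0 : p = 0.
  apply/eqP/negP => /negP p_neq0; have [s [us ss sU]] := U_infinite i (size p).
  have := max_poly_roots p_neq0 _ us; rewrite ss ltnn => H.
  by have : false by apply: H; apply/allP => x /sU/p_root.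
have := congr1 (fun q : {poly R} => q`_(m0 i)) p0.
rewrite coef0 /p coef_sum => e; rewrite -[RHS]e /M' big_filter big_mkcond /=.
apply: eq_bigr => m _; rewrite coefZ coefXn eq_sym.
by case: eqP; rewrite ?mulr1 ?mulr0.
Qed.

Lemma peval_eq0_on_infinite_box (P : malg (cmonom I) R) :
  (forall v, (forall i, U i (v i)) -> peval v P = 0) -> P = 0.
Proof.
move=> vanish.
pose d := [fset i in flatten [seq enum_fset (finsupp m) | m : cmonom I <- enum_fset (msupp P)]]%fset.
have domd m : m \in msupp P -> (finsupp m `<=` d)%fset.
  move=> mP; apply/fsubsetP => i im; rewrite !inE; apply/flattenP.
  by exists (enum_fset (finsupp m)) => //; apply: map_f.
have inj m m' : m \in msupp P -> m' \in msupp P -> {in d, m =1 m'} -> m = m'.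
  move=> mP m'P e; apply/eqP/cmP => i.
  have [/e //|id] := boolP (i \in d).
  have out m2 : m2 \in msupp P -> m2 i = 0.
    by move=> /domd/fsubsetP sub; apply/eqP; rewrite cmE_eq0; apply: contra id => /sub.
  by rewrite !out.
apply/malgP => m; rewrite mcoeff0.
have [mP|/mcoeff_outdom //] := boolP (m \in msupp P).
apply: (@monomials_free (fun m => mcoeff m P) d (msupp P)) => //; try exact: fset_uniq.
move=> v vU; rewrite -[RHS](vanish v vU) /peval mmapE.
by apply: eq_big_seq => m' m'P; rewrite (mon_evalEw _ (domd _ m'P)).
Qed.

End PolynomialVanishing.

Section PolynomialInduction.
Context (I : choiceType) (R : comNzRingType).

Lemma pconstM_mon (c : R) (m : cmonom I) : mkmalgU m c = pconst I c * mkmalgU m 1.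
Proof. by rewrite mkmalgUM mul1m mulr1. Qed.

Lemma mpoly_ind (Q : malg (cmonom I) R -> Prop) :
  (forall c, Q (pconst I c)) -> (forall i, Q (pvar R i)) ->
  (forall a b, Q a -> Q b -> Q (a + b)) ->
  (forall a b, Q a -> Q b -> Q (a * b)) -> forall P, Q P.
Proof.
move=> Qc Qv QD QM P.
have Q0 : Q 0 by have := Qc 0; rewrite /pconst monalgU0.
have Qm m : Q (mkmalgU m 1).
  have [n] := ubnP (mdeg m); elim: n m => // n IH m le.
  have [/mdeg_eq0I ->|] := eqVneq (mdeg m) 0%N; first exact: Qc.
  move=> m_neq0.
  have [i im] : exists i, i \in finsupp m.
    apply/fset0Pn; apply: contra_neq m_neq0 => e.
    by rewrite mdegE e big_seq_fset0.
  have e : m = mmul (ucm i) (divcm m (ucm i)).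
    apply/eqP/cmP => j; rewrite cmM divcmE ucmE.
    by case: eqP => [<-|_]; rewrite ?subn0 // subnKC // lt0n cmE_neq0.
  have -> : mkmalgU m 1 = pvar R i * mkmalgU (divcm m (ucm i)) 1.
    by rewrite mkmalgUM -e mulr1.
  apply: QM => //; apply: IH.
  by move: le; rewrite {1}e mdegM mdegU.
rewrite (monalgE P); apply: big_ind => // m _.
by rewrite pconstM_mon; apply: QM.
Qed.

End PolynomialInduction.

(** * Symmetry of second derivatives *)

(** Directional derivatives only see the increments along the direction; this
    transports them between a function and its restriction to a line, or its
    translates. *)
Lemma is_derive_increment (R : numFieldType) (V V' W : normedModType R)
    (f : V -> W) (g : V' -> W) (x v : V) (y w : V') (d : W) :
  (forall h, f (h *: v + x) - f x = g (h *: w + y) - g y) ->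
  is_derive x v f d -> is_derive y w g d.
Proof.
move=> e [+ +]; rewrite /derivable /derive.
set F := (X in X @ _); set G := fun h : R => h^-1 *: (g (h *: w + y) - g y).
suff -> : F = G by move=> ? <-.
by apply/funext => h; rewrite /F /G -e.
Qed.

Section MixedDerivatives.
Context (R : realType) (V : normedModType R).
Implicit Types (F : V -> R) (p v w : V) (Omega : set V).

Lemma derivable_line F p v c : derivable F (p + c *: v) v ->
  is_derive c 1 (fun h : R => F (p + h *: v)) ('D_v F (p + c *: v)).
Proof.
move/derivableP; apply: is_derive_increment => h.
by rewrite scalerDl [_ *: 1]mulr1 addrCA.
Qed.

Lemma directional_MVT F p v h : 0 < h ->
  (forall c, 0 <= c <= h -> derivable F (p + c *: v) v) ->
  exists2 c, 0 <= c <= h & F (p + h *: v) - F p = h * 'D_v F (p + c *: v).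
Proof.
move=> h0 dF.
have d1 c : c \in `]0, h[ -> is_derive c 1 (fun c => F (p + c *: v))
    ('D_v F (p + c *: v)).
  rewrite in_itv /= => /andP[/ltW c0 /ltW ch].
  by apply/derivable_line/dF; rewrite c0 ch.
have cont : {within `[0, h], continuous (fun c => F (p + c *: v))}.
  apply: derivable_within_continuous => c; rewrite in_itv /= => /dF.
  by move=> /derivable_line[].
have [c] := MVT_segment (ltW h0) d1 cont.
by rewrite in_itv /= scale0r addr0 subr0 mulrC => ch e; exists c.
Qed.

(** Mean value theorem along [v] for the difference [F (_ + h w) - F], then along
    [w] for ['D_v F]. *)
Lemma second_difference F p v w h : 0 < h ->
  (forall c d, 0 <= c <= h -> 0 <= d <= h ->
    derivable F (p + c *: v + d *: w) v /\
    derivable ('D_v F) (p + c *: v + d *: w) w) ->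
  exists c d, [/\ 0 <= c <= h, 0 <= d <= h &
    F (p + h *: v + h *: w) - F (p + h *: v) - F (p + h *: w) + F p
    = h ^+ 2 * 'D_w ('D_v F) (p + c *: v + d *: w)].
Proof.
move=> h0 dF.
have hh : 0 <= h <= h by rewrite lexx ltW.
have h00 : 0 <= (0 : R) <= h by rewrite lexx ltW.
pose G q := F (h *: w + q) - F q.
have dG c : 0 <= c <= h -> is_derive (p + c *: v) v G
    ('D_v F (p + c *: v + h *: w) - 'D_v F (p + c *: v)).
  move=> ch; have [d1 _] := dF _ _ ch hh; have [d2 _] := dF _ _ ch h00.
  rewrite scale0r addr0 in d2.
  apply: is_deriveB; last exact: derivableP.
  apply: is_derive_increment (derivableP d1) => k.
  by rewrite ![h *: w + _]addrC addrA.
have [c ch e] : exists2 c, 0 <= c <= h & G (p + h *: v) - G p = h * 'D_v G (p + c *: v).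
  by apply: directional_MVT => // c /dG [].
have [d dh e'] := directional_MVT h0 (fun d dh => (dF c d ch dh).2).
exists c, d; split=> //.
have [_ e2] := dG c ch; move: e; rewrite e2 e' mulrA -expr2 => <-.
by rewrite /G ![h *: w + _]addrC; ring.
Qed.

Lemma nbhs_parallelogram p v w (B : set V) : nbhs p B ->
  exists2 h : R, 0 < h & forall c d, 0 <= c <= h -> 0 <= d <= h ->
    B (p + c *: v + d *: w).
Proof.
move=> /nbhs_normP[e /= e0 eB].
have k0 : 0 < `|v| + `|w| + 1 by rewrite ltr_wpDl // addr_ge0.
exists (e / (`|v| + `|w| + 1)); first exact: divr_gt0.
move=> c d /andP[c0 ch] /andP[d0 dh]; apply: eB => /=.
rewrite -addrA opprD addrA subrr sub0r normrN.
apply: le_lt_trans (ler_normD _ _) _; rewrite !normrZ !ger0_norm //.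
have vge := normr_ge0 v; have wge := normr_ge0 w.
have : c * `|v| + d * `|w| <= e / (`|v| + `|w| + 1) * (`|v| + `|w|).
  by rewrite mulrDr lerD // ler_wpM2r.
move=> /le_lt_trans; apply.
rewrite -[ltRHS](divfK (lt0r_neq0 k0)) ltr_pM2l ?divr_gt0 //.
by rewrite ltrDl.
Qed.

(** The second difference of [F] over a parallelogram is symmetric in [v] and [w];
    divided by [h ^+ 2], it is a value of either iterated derivative at a
    point close to [p], and both are continuous at [p]. *)
Lemma derive_commute Omega F v w p : open Omega -> Omega p ->
  (forall q, Omega q -> derivable F q v /\ derivable F q w) ->
  (forall q, Omega q -> derivable ('D_v F) q w /\ derivable ('D_w F) q v) ->
  {for p, continuous ('D_w ('D_v F))} -> {for p, continuous ('D_v ('D_w F))} ->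
  'D_w ('D_v F) p = 'D_v ('D_w F) p.
Proof.
move=> oO Op dF ddF cvw cwv; apply/eqP; rewrite -subr_eq0 -normr_le0.
apply/ler_addgt0Pr => e e0; rewrite add0r.
have e20 : 0 < e / 2 by rewrite divr_gt0.
have B1 : nbhs p [set q | `|'D_w ('D_v F) p - 'D_w ('D_v F) q| < e / 2].
  by move/cvgrPdist_lt: cvw; apply.
have B2 : nbhs p [set q | `|'D_v ('D_w F) p - 'D_v ('D_w F) q| < e / 2].
  by move/cvgrPdist_lt: cwv; apply.
have BO : nbhs p Omega by exact: open_nbhs_nbhs.
have [h h0 H] := nbhs_parallelogram v w (filterI BO (filterI B1 B2)).
have [c [d [ch dh e1]]] := @second_difference F p v w h h0
  (fun c d ch dh => conj (dF _ (H c d ch dh).1).1 (ddF _ (H c d ch dh).1).1).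
have H' c' d' : 0 <= c' <= h -> 0 <= d' <= h ->
    (Omega `&` ([set q | `|'D_w ('D_v F) p - 'D_w ('D_v F) q| < e / 2]
     `&` [set q | `|'D_v ('D_w F) p - 'D_v ('D_w F) q| < e / 2]))
    (p + c' *: w + d' *: v).
  by move=> c'h d'h; rewrite addrAC; exact: H.
have [c' [d' [c'h d'h e2]]] := @second_difference F p w v h h0
  (fun c d ch dh => conj (dF _ (H' c d ch dh).1).2 (ddF _ (H' c d ch dh).1).2).
have same_quotient (a a' b b' g X Y : R) : a = a' -> a - b - b' + g = h ^+ 2 * X ->
    a' - b' - b + g = h ^+ 2 * Y -> X = Y.
  move=> <- eX eY; apply: (mulfI (_ : h ^+ 2 != 0)).
    by rewrite expf_neq0 // lt0r_neq0.
  by rewrite -eX -eY; ring.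
have e12 := same_quotient _ _ _ _ _ _ _ (congr1 F (addrAC p (h *: v) (h *: w))) e1 e2.
have close (X Y Z Z' : R) : Z = Z' -> `|X - Z| < e / 2 -> `|Y - Z'| < e / 2 -> `|X - Y| <= e.
  move=> -> XZ YZ; rewrite distrC in YZ; rewrite [e]splitr.
  exact/ltW/(le_lt_trans (ler_distD Z' _ _))/ltrD.
exact: (close _ _ _ _ e12 (H c d ch dh).2.1 (H' c' d' c'h d'h).2.2).
Qed.

End MixedDerivatives.

(** * The operators annihilating one function *)

Section PointwiseDerivatives.
Context (R : numFieldType) (V : normedModType R).
Implicit Types (F G : V -> R) (p v : V) (a b : R).

Lemma is_derive_add F G p v a b : is_derive p v F a -> is_derive p v G b ->
  is_derive p v (fun q => F q + G q) (a + b).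
Proof. exact: is_deriveD. Qed.

Lemma is_derive_mul F G p v a b : is_derive p v F a -> is_derive p v G b ->
  is_derive p v (fun q => F q * G q) (a * G p + F p * b).
Proof.
move=> dF dG; apply: (is_derive_eq (is_deriveM dF dG)).
by rewrite addrC; congr (_ + _); exact: mulrC.
Qed.

Lemma is_derive_const c p v : is_derive p v (fun=> c : R) 0.
Proof. exact: is_derive_cst. Qed.

Lemma is_derive_opp F p v a : is_derive p v F a -> is_derive p v (fun q => - F q) (- a).
Proof. exact: is_deriveN. Qed.

Lemma is_derive_by F p v a : (exists2 b, is_derive p v F b & b = a) -> is_derive p v F a.
Proof. by case=> b dF <-. Qed.

End PointwiseDerivatives.

Lemma is_derive_coordinates (R : numFieldType) (p v : R * R) :
  is_derive p v (fun q : R * R => q.1) v.1 /\ is_derive p v (fun q : R * R => q.2) v.2.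
Proof.
by split; [apply: is_derive_increment (is_derive_id p.1 v.1)
  |apply: is_derive_increment (is_derive_id p.2 v.2)].
Qed.

(* Instance search would try to unfold the functions to be differentiated, so the
   Leibniz rules are applied without it. *)
Ltac leibniz := repeat match goal with
  | |- is_derive _ _ (fun=> _) _ => exact: is_derive_const
  | |- is_derive _ _ (fun p => p.1) _ => exact: (is_derive_coordinates _ _).1
  | |- is_derive _ _ (fun p => p.2) _ => exact: (is_derive_coordinates _ _).2
  | |- is_derive _ _ (fun p => @?F p + @?G p) _ =>
      notypeclasses refine (@is_derive_add _ _ F G _ _ _ _ _ _)
  | |- is_derive _ _ (fun p => @?F p * @?G p) _ =>
      notypeclasses refine (@is_derive_mul _ _ F G _ _ _ _ _ _)
  | |- is_derive _ _ (fun p => - @?F p) _ =>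
      notypeclasses refine (@is_derive_opp _ _ F _ _ _ _)
  | H : forall p v, is_derive p v ?F _ |- is_derive _ _ ?F _ => exact: H
  end.

Section JetsOfSmoothFunctions.
Context (R : realType) (Omega : set (R * R)) (f : R * R -> R).
Hypotheses (Omega_open : open Omega) (f_smooth : smooth_on Omega f).
Implicit Types p : R * R.

Let ex : R * R := (1, 0).
Let ey : R * R := (0, 1).

Lemma partialE i j : partial i j f = partials (nseq i true ++ nseq j false) f.
Proof.
rewrite /partial /partials foldr_cat.
elim: i => [|i IH] /=; last by rewrite IH.
by elim: j => //= j ->.
Qed.

Lemma Omega_near p : Omega p -> \forall q \near p, Omega q.
Proof. by move=> Op; apply: open_nbhs_nbhs. Qed.

Lemma partials_swap w p : Omega p ->
  partials [:: false, true & w] f p = partials [:: true, false & w] f p.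
Proof.
move=> Op.
have d1 q : Omega q -> derivable (partials w f) q ex /\ derivable (partials w f) q ey.
  by move=> /(f_smooth w)[_ dx dy]; split; [exact: dx|exact: dy].
have d2 q : Omega q -> derivable (partials (true :: w) f) q ey /\
    derivable (partials (false :: w) f) q ex.
  move=> Oq; have [_ _ dy] := f_smooth (true :: w) Oq.
  by have [_ dx _] := f_smooth (false :: w) Oq; split; [exact: dy|exact: dx].
have [c1 _ _] := f_smooth [:: false, true & w] Op.
have [c2 _ _] := f_smooth [:: true, false & w] Op.
exact: (derive_commute Omega_open Op d1 d2 c1 c2).
Qed.

(** [partial i.+1 j] prepends [partial_x], but [partial i j.+1] inserts [partial_y]
    under the [i] derivatives along [x]; it has to be commuted through them. *)
Lemma partials_sorted i j p : Omega p ->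
  partials (false :: nseq i true ++ nseq j false) f p = partial i j.+1 f p.
Proof.
rewrite partialE; elim: i p => [|i IH] p Op //.
rewrite [LHS]partials_swap // /=.
by apply: near_eq_derive; near=> q; apply: IH; near: q; exact: Omega_near.
Unshelve. all: by end_near. Qed.

Lemma is_derive_partial_x i j p : Omega p ->
  is_derive p ex (partial i j f) (partial i.+1 j f p).
Proof.
move=> Op; rewrite !partialE.
by have [_ /derivableP] := f_smooth (nseq i true ++ nseq j false) Op.
Qed.

Lemma is_derive_partial_y i j p : Omega p ->
  is_derive p ey (partial i j f) (partial i j.+1 f p).
Proof.
move=> Op; rewrite -partials_sorted // partialE.
by have [_ _ /derivableP] := f_smooth (nseq i true ++ nseq j false) Op.
Qed.

Lemma morph_derivationM (A : comNzRingType) (phi : {rmorphism A -> R}) (D : A -> A) :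
  derivation D -> forall a b, phi (D (a * b)) = phi (D a) * phi b + phi a * phi (D b).
Proof. by move=> [_ DM] a b; rewrite DM rmorphD !rmorphM. Qed.

Lemma is_derive_jet_eval (v : R * R) (delta : jet_var -> jet_poly R) P p :
  (forall i q, Omega q ->
    is_derive q v (jet_val f ^~ i) (jet_eval f q (delta i))) ->
  Omega p -> is_derive p v (fun q => jet_eval f q P) (jet_eval f p (pder delta P)).
Proof.
move=> der_val Op; elim/mpoly_ind: P => [c|i|a b IHa IHb|a b IHa IHb].
- rewrite pder_const rmorph0.
  under eq_fun do rewrite /jet_eval peval_const.
  exact: is_derive_const.
- rewrite pder_var; under eq_fun do rewrite /jet_eval peval_var.
  exact: der_val.
- rewrite pderD rmorphD; under eq_fun do rewrite rmorphD.
  exact: (is_derive_add IHa IHb).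
- have -> : jet_eval f p (pder delta (a * b)) = jet_eval f p (pder delta a) *
      jet_eval f p b + jet_eval f p a * jet_eval f p (pder delta b).
    exact: (morph_derivationM (jet_eval f p) (pder_derivation delta)).
  under eq_fun do rewrite rmorphM.
  exact: (is_derive_mul IHa IHb).
Qed.

Lemma is_derive_jet_eval_x P p : Omega p ->
  is_derive p ex (fun q => jet_eval f q P) (jet_eval f p (pder (@jet_delta_x R) P)).
Proof.
apply: is_derive_jet_eval => i q Oq; case: i => [||i j].
- by rewrite rmorph1; have [] := is_derive_coordinates q ex.
- by rewrite rmorph0; have [] := is_derive_coordinates q ex.
- by rewrite jet_eval_d; exact: is_derive_partial_x.
Qed.

Lemma is_derive_jet_eval_y P p : Omega p ->
  is_derive p ey (fun q => jet_eval f q P) (jet_eval f p (pder (@jet_delta_y R) P)).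
Proof.
apply: is_derive_jet_eval => i q Oq; case: i => [||i j].
- by rewrite rmorph0; have [] := is_derive_coordinates q ey.
- by rewrite rmorph1; have [] := is_derive_coordinates q ey.
- by rewrite jet_eval_d; exact: is_derive_partial_y.
Qed.

Lemma is_derive_vanishing (F : R * R -> R) p (v : R * R) d :
  (forall q, Omega q -> F q = 0) -> Omega p -> is_derive p v F d -> d = 0.
Proof.
move=> F0 Op [_ <-]; rewrite -(derive_cst (0 : R) p v).
by apply: near_eq_derive; near=> q; apply: F0; near: q; exact: Omega_near.
Unshelve. all: by end_near. Qed.

End JetsOfSmoothFunctions.

Section LocalizedIdeal.
Context (P : comNzRingType) (S : mulrClosed P) (Z : set P) (A : set (loc S)).
Hypotheses (Z0 : Z 0) (ZD : forall a b, Z a -> Z b -> Z (a + b))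
           (ZM : forall a b, Z b -> Z (a * b)).
Hypothesis A_frac : forall r s, A (frac r s) <-> Z r.

(** By the quotient rule, vanishing of the numerator is inherited by [loc_der]. *)
Lemma localized_diff_ideal (Ds : set (loc S -> loc S)) :
  (forall D, Ds D -> exists2 d, derivation d & D = loc_der d /\ forall a, Z a -> Z (d a)) ->
  diff_ideal Ds A.
Proof.
move=> DsP; split.
- by apply/A_frac.
- elim/fracW => r s; elim/fracW => r' s' /A_frac r0 /A_frac r0'; rewrite fracD.
  by apply/A_frac/ZD; rewrite mulrC; exact: ZM.
- elim/fracW => r s; elim/fracW => r' s' /A_frac r0; rewrite fracM.
  by apply/A_frac/ZM.
- move=> D /DsP[d dd [-> Zd]]; elim/fracW => r s /A_frac r0.
  rewrite loc_der_frac //; apply/A_frac.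
  rewrite mulrC -mulNr [- r * _]mulrC mulrN -mulNr.
  by apply: ZD; apply: ZM => //; exact: Zd.
Qed.

End LocalizedIdeal.

Section AnnihilatorOfOneFunction.
Context (R : realType) (Omega : set (R * R)) (f : R * R -> R).
Hypotheses (Omega_open : open Omega) (f_generic : generic Omega f).

Lemma jet_act_eq0 r (s : {s | s \in jet_S R}) p : Omega p ->
  jet_act (frac r s) f p = 0 <-> jet_eval f p r = 0.
Proof.
move=> Op; rewrite (jet_act_frac _ _ f_generic Op).
have s0 := jet_eval_S_neq0 f_generic Op (valP s).
split=> [/eqP|->]; last by rewrite mul0r.
by rewrite mulf_eq0 invr_eq0 (negbTE s0) orbF => /eqP.
Qed.

Lemma annihilator1_frac r (s : {s | s \in jet_S R}) :
  annihilator Omega [set f] (frac r s) <-> forall p, Omega p -> jet_eval f p r = 0.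
Proof.
split=> [ann p Op|r0 g -> p Op]; last by apply/jet_act_eq0 => //; exact: r0.
by apply/(@jet_act_eq0 r s p Op)/ann.
Qed.

Lemma annihilator1_diff_ideal :
  diff_ideal [set @jet_Dx R; @jet_Dy R] (annihilator Omega [set f]).
Proof.
have ideal (A : comNzRingType) (phi : R * R -> {rmorphism A -> R}) :
    let Z := [set a | forall p, Omega p -> phi p a = 0] in
    [/\ Z 0, forall a b, Z a -> Z b -> Z (a + b) & forall a b, Z b -> Z (a * b)].
  split=> [p _|a b a0 b0 p Op|a b b0 p Op]; first exact: rmorph0.
    by rewrite rmorphD a0 // b0 // addr0.
  by rewrite rmorphM b0 // mulr0.
have [Z0 ZD ZM] := ideal _ (fun p => jet_eval f p).
apply: (localized_diff_ideal Z0 ZD ZM annihilator1_frac) => D [|] ->.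
- exists (pder (@jet_delta_x R)); [exact: pder_derivation|split=> // a a0 p Op].
  exact: (is_derive_vanishing Omega_open a0 Op
    (is_derive_jet_eval_x f_generic.1 a Op)).
- exists (pder (@jet_delta_y R)); [exact: pder_derivation|split=> // a a0 p Op].
  exact: (is_derive_vanishing Omega_open a0 Op
    (is_derive_jet_eval_y Omega_open f_generic.1 a Op)).
Qed.

End AnnihilatorOfOneFunction.

(** * Quadrics satisfy the two equations *)

(** [u i j] is the derivative of [f] of order [i] in [x] and [j] in [y].
    Below, [k] is the derivative of the quadric equation along [z], while [al] and
    [be] are the partial derivatives of [k], taken along the graph. *)
Section QuadricRelation.
Context (R : realType) (Omega : set (R * R)) (u : nat -> nat -> R * R -> R).
Hypothesis Omega_open : open Omega.
Hypotheses
  (ux : forall i j p, Omega p -> is_derive p ((1 : R), (0 : R)) (u i j) (u i.+1 j p))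
  (uy : forall i j p, Omega p -> is_derive p ((0 : R), (1 : R)) (u i j) (u i j.+1 p)).
Context (a11 a12 a13 a22 a23 a33 b1 b2 b3 c : R).
Hypothesis rel : forall p, Omega p ->
  a11 * (p.1 * p.1) + a12 * (p.1 * p.2) + a13 * (p.1 * u 0 0 p)
  + a22 * (p.2 * p.2) + a23 * (p.2 * u 0 0 p) + a33 * (u 0 0 p * u 0 0 p)
  + b1 * p.1 + b2 * p.2 + b3 * u 0 0 p + c = 0.

Local Notation k p := (a13 * p.1 + a23 * p.2 + 2 * a33 * u 0 0 p + b3).
Local Notation al p := (a13 + 2 * a33 * u 1 0 p).
Local Notation be p := (a23 + 2 * a33 * u 0 1 p).

Ltac leibniz_jet := leibniz;
  match goal with
  | |- is_derive _ (1, 0) _ _ => apply: ux; assumption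
  | |- is_derive _ (0, 1) _ _ => apply: uy; assumption
  end.

Ltac differentiate E v :=
  let Op := fresh "Op" in move=> Op;
  apply: (@is_derive_vanishing _ _ Omega_open _ _ v _ E Op);
  apply: is_derive_by; eexists; [by leibniz_jet | rewrite /=; ring].

Ltac diff_x E := differentiate E ((1 : R), (0 : R)).
Ltac diff_y E := differentiate E ((0 : R), (1 : R)).

Lemma rel_x p : Omega p -> 2 * a11 * p.1 + a12 * p.2 + a13 * u 0 0 p + b1
  + k p * u 1 0 p = 0.
Proof. diff_x rel. Qed.

Lemma rel_y p : Omega p -> a12 * p.1 + 2 * a22 * p.2 + a23 * u 0 0 p + b2
  + k p * u 0 1 p = 0.
Proof. diff_y rel. Qed.

Lemma rel_xx p : Omega p ->
  2 * a11 + 2 * a13 * u 1 0 p + 2 * a33 * (u 1 0 p * u 1 0 p) + k p * u 2 0 p = 0.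
Proof. diff_x rel_x. Qed.

Lemma rel_xy p : Omega p ->
  a12 + a13 * u 0 1 p + be p * u 1 0 p + k p * u 1 1 p = 0.
Proof. diff_y rel_x. Qed.

Lemma rel_yy p : Omega p ->
  2 * a22 + 2 * a23 * u 0 1 p + 2 * a33 * (u 0 1 p * u 0 1 p) + k p * u 0 2 p = 0.
Proof. diff_y rel_y. Qed.

Lemma rel_xxx p : Omega p -> 3 * al p * u 2 0 p + k p * u 3 0 p = 0.
Proof. diff_x rel_xx. Qed.

Lemma rel_xxy p : Omega p ->
  2 * al p * u 1 1 p + be p * u 2 0 p + k p * u 2 1 p = 0.
Proof. diff_y rel_xx. Qed.

Lemma rel_xyy p : Omega p ->
  2 * be p * u 1 1 p + al p * u 0 2 p + k p * u 1 2 p = 0.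
Proof. diff_x rel_yy. Qed.

Lemma rel_yyy p : Omega p -> 3 * be p * u 0 2 p + k p * u 0 3 p = 0.
Proof. diff_y rel_yy. Qed.

Lemma rel_xxxx p : Omega p ->
  6 * a33 * (u 2 0 p * u 2 0 p) + 4 * al p * u 3 0 p + k p * u 4 0 p = 0.
Proof. diff_x rel_xxx. Qed.

Hypothesis coef_neq0 : [|| a11 != 0, a12 != 0, a13 != 0, a22 != 0, a23 != 0,
  a33 != 0, b1 != 0, b2 != 0, b3 != 0 | c != 0].

(** If [k] is zero at a point, the derivatives of order 3 give [al = be = 0] there,
    the one of order 4 gives [a33 = 0], and then [a13], [a23] and all the other
    coefficients vanish in turn. *)
Lemma vertical_derivative_neq0 p : Omega p ->
  u 2 0 p != 0 -> u 0 2 p != 0 -> k p != 0.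
Proof.
move=> Op r0 t0; apply/negP => /eqP k0.
have e0 := rel Op; have ex1 := rel_x Op; have ey1 := rel_y Op.
have exx := rel_xx Op; have exy := rel_xy Op; have eyy := rel_yy Op.
have e3x := rel_xxx Op; have e3y := rel_yyy Op; have e4 := rel_xxxx Op.
rewrite k0 !mul0r !addr0 in ex1 ey1 exx exy eyy e3x e3y e4.
have three : (3 : R) != 0 by rewrite pnatr_eq0.
have al0 : al p = 0.
  by apply/eqP; move/eqP: e3x; rewrite !mulf_eq0 (negbTE r0) (negbTE three) orbF.
have be0 : be p = 0.
  by apply/eqP; move/eqP: e3y; rewrite !mulf_eq0 (negbTE t0) (negbTE three) orbF.
have a33_0 : a33 = 0.
  move/eqP: e4; rewrite al0 mulr0 mul0r addr0 !mulf_eq0 (negbTE r0) !orbF.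
  by rewrite pnatr_eq0 /= => /eqP.
have a13_0 : a13 = 0 by move: al0; rewrite a33_0; lra.
have a23_0 : a23 = 0 by move: be0; rewrite a33_0; lra.
have a11_0 : a11 = 0 by move: exx; rewrite a13_0 a33_0; lra.
have a12_0 : a12 = 0 by move: exy; rewrite a13_0 a23_0 a33_0; lra.
have a22_0 : a22 = 0 by move: eyy; rewrite a23_0 a33_0; lra.
have b1_0 : b1 = 0 by move: ex1; rewrite a11_0 a12_0 a13_0; lra.
have b2_0 : b2 = 0 by move: ey1; rewrite a12_0 a22_0 a23_0; lra.
have b3_0 : b3 = 0 by move: k0; rewrite a13_0 a23_0 a33_0; lra.
have c_0 : c = 0.
  by move: e0; rewrite a11_0 a12_0 a13_0 a22_0 a23_0 a33_0 b1_0 b2_0 b3_0; lra.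
by move: coef_neq0; rewrite a11_0 a12_0 a13_0 a22_0 a23_0 a33_0 b1_0 b2_0 b3_0
  c_0 eqxx.
Qed.

(** Multiply by [k] and eliminate the third derivatives with [rel_xxx], [rel_xxy],
    [rel_xyy] and [rel_yyy]; [al] and [be] cancel. *)
Lemma quadric_pde p : Omega p -> u 2 0 p != 0 -> u 0 2 p != 0 ->
  u 3 0 p * u 0 2 p ^+ 2 - 3 * u 1 2 p * u 2 0 p * u 0 2 p
    + 2 * u 0 3 p * u 1 1 p * u 2 0 p = 0 /\
  u 0 3 p * u 2 0 p ^+ 2 - 3 * u 2 1 p * u 0 2 p * u 2 0 p
    + 2 * u 3 0 p * u 1 1 p * u 0 2 p = 0.
Proof.
move=> Op r0 t0; have k0 := vertical_derivative_neq0 Op r0 t0.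
have e30 := rel_xxx Op; have e21 := rel_xxy Op.
have e12 := rel_xyy Op; have e03 := rel_yyy Op.
move: (k p) (al p) (be p) k0 e30 e21 e12 e03 => K al be K0 e30 e21 e12 e03.
split; apply: (mulfI K0); rewrite mulr0.
- transitivity ((3 * al * u 2 0 p + K * u 3 0 p) * u 0 2 p ^+ 2
    - 3 * (2 * be * u 1 1 p + al * u 0 2 p + K * u 1 2 p) * (u 2 0 p * u 0 2 p)
    + 2 * (3 * be * u 0 2 p + K * u 0 3 p) * (u 1 1 p * u 2 0 p)); first by ring.
  by rewrite e30 e12 e03; ring.
- transitivity ((3 * be * u 0 2 p + K * u 0 3 p) * u 2 0 p ^+ 2
    - 3 * (2 * al * u 1 1 p + be * u 2 0 p + K * u 2 1 p) * (u 0 2 p * u 2 0 p)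
    + 2 * (3 * al * u 2 0 p + K * u 3 0 p) * (u 1 1 p * u 0 2 p)); first by ring.
  by rewrite e30 e21 e03; ring.
Qed.

End QuadricRelation.

Section GeneratorsAnnihilate.
Context (R : realType) (Omega : set (R * R)).
Hypothesis Omega_open : open Omega.

Lemma morph_gen (A : comNzRingType) (C : pzRingType) (phi : {rmorphism A -> C})
    (a b c d e f : A) :
  phi (a * b ^+ 2 - 3 * c * d * b + 2 * e * f * d) =
  phi a * phi b ^+ 2 - 3 * phi c * phi d * phi b + 2 * phi e * phi f * phi d.
Proof. by rewrite rmorphD rmorphB !rmorphM !rmorph_nat. Qed.

Lemma quadric_gens_annihilate f : quadric Omega f ->
  annihilator Omega [set f] (quadric_gen1 R) /\
  annihilator Omega [set f] (quadric_gen2 R).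
Proof.
move=> [fgen [a11 [a12 [a13 [a22 [a23 [a33 [b1 [b2 [b3 [c [coef rel]]]]]]]]]]]].
have rel' p : Omega p -> a11 * (p.1 * p.1) + a12 * (p.1 * p.2)
    + a13 * (p.1 * partial 0 0 f p) + a22 * (p.2 * p.2)
    + a23 * (p.2 * partial 0 0 f p) + a33 * (partial 0 0 f p * partial 0 0 f p)
    + b1 * p.1 + b2 * p.2 + b3 * partial 0 0 f p + c = 0.
  by case: p => x y Op; rewrite -(rel x y Op) /= /partial /=; ring.
have pde := quadric_pde Omega_open
  (fun i j p Op => is_derive_partial_x fgen.1 i j Op)
  (fun i j p Op => is_derive_partial_y Omega_open fgen.1 i j Op) rel' coef.
rewrite /quadric_gen1 /quadric_gen2.
split; apply/(annihilator1_frac fgen) => p Op; have [t0 r0 _] := fgen.2 p Op;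
  have [e1 e2] := pde p Op r0 t0.
- rewrite -!(jet_eval_d f p) in e1.
  exact: (etrans (morph_gen (jet_eval f p) _ _ _ _ _ _) e1).
- rewrite -!(jet_eval_d f p) in e2.
  exact: (etrans (morph_gen (jet_eval f p) _ _ _ _ _ _) e2).
Qed.

End GeneratorsAnnihilate.

(** * Quadrics with prescribed jets *)

Lemma is_derive_comp1 (R : realType) (V : normedModType R) (phi : R -> R)
    (F : V -> R) (p v : V) (d e : R) :
  is_derive p v F d -> is_derive (F p) 1 phi e ->
  is_derive p v (fun q => phi (F q)) (e * d).
Proof.
move=> dF dphi.
pose g (h : R) := F (h *: v + p).
have g0 : g 0 = F p by rewrite /g scale0r add0r.
have line (G : V -> R) (h : R) : G (h *: v + p) - G p
    = G ((h *: (1 : R) + 0 : R) *: v + p) - G ((0 : R) *: v + p).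
  by rewrite scale0r add0r addr0 [h *: 1]mulr1.
have dg : is_derive (0 : R) 1 g d by exact: (is_derive_increment (line F) dF).
rewrite -g0 in dphi; have := is_derive1_comp dphi dg.
by apply: is_derive_increment => h; exact: (esym (line (phi \o F) h)).
Qed.

Lemma is_derive_partialP (R : realType) (F F' : R * R -> R) :
  ((forall p, is_derive p ((1 : R), (0 : R)) F (F' p)) -> partial_x F = F') /\
  ((forall p, is_derive p ((0 : R), (1 : R)) F (F' p)) -> partial_y F = F').
Proof. by split=> dF; apply/funext => p; have [_] := dF p. Qed.

Section OvalQuadric.
Context (R : realType) (x0 y0 g0 m n r s t e0 e1 e2 : R).
Hypotheses (g0_gt0 : 0 < g0) (r_gt0 : 0 < r) (hess_gt0 : s ^+ 2 < r * t).
Implicit Types p : R * R.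

(** Around [(x0, y0)] this is the square of an affine form plus [g0] times a positive
    definite quadratic form, chosen so that [sqrt oval_q] has value [g0],
    gradient [(m * g0, n * g0)] and second derivatives [r], [s], [t] there. *)
Definition oval_q p := g0 ^+ 2 * (1 + m * (p.1 - x0) + n * (p.2 - y0)) ^+ 2
  + g0 * (r * (p.1 - x0) ^+ 2 + 2 * s * (p.1 - x0) * (p.2 - y0)
          + t * (p.2 - y0) ^+ 2).

(** [r * oval_q] is a combination with positive coefficients of the squares of three
    affine forms without common zero. *)
Lemma oval_q_gt0 p : 0 < oval_q p.
Proof.
rewrite /oval_q; move: (p.1 - x0) (p.2 - y0) => a b.
rewrite -(pmulr_rgt0 _ r_gt0).
have -> : r * (g0 ^+ 2 * (1 + m * a + n * b) ^+ 2 + g0 * (r * a ^+ 2 + 2 * s * a * b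
    + t * b ^+ 2)) = (r * g0 ^+ 2) * (1 + m * a + n * b) ^+ 2
    + g0 * ((r * a + s * b) ^+ 2 + (r * t - s ^+ 2) * b ^+ 2) by ring.
have h0 : 0 < r * t - s ^+ 2 by rewrite subr_gt0.
have rg : 0 < r * g0 ^+ 2 by rewrite mulr_gt0 // exprn_gt0.
have bt : 0 <= (r * t - s ^+ 2) * b ^+ 2 by rewrite mulr_ge0 ?sqr_ge0 // ltW.
have [b_eq0|b_neq0] := eqVneq b 0.
  rewrite b_eq0 !mulr0 !addr0 expr0n /= mulr0 addr0.
  have [->|a_neq0] := eqVneq a 0.
    by rewrite !mulr0 !addr0 expr0n /= mulr0 addr0 expr1n mulr1.
  rewrite ltr_wpDl //; first by rewrite mulr_ge0 ?sqr_ge0 // ltW.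
  by rewrite mulr_gt0 // lt_def sqr_ge0 sqrf_eq0 mulf_neq0 // gt_eqF.
rewrite ltr_wpDl //; first by rewrite mulr_ge0 ?sqr_ge0 // ltW.
rewrite mulr_gt0 // ltr_wpDl ?sqr_ge0 // mulr_gt0 //.
by rewrite lt_def sqr_ge0 sqrf_eq0 b_neq0.
Qed.

(** The derivatives of [sqrt oval_q] are polynomials in [x], [y] and [oval_w]. *)
Definition oval_w p := (Num.sqrt (oval_q p))^-1.

Lemma oval_w_gt0 p : 0 < oval_w p.
Proof. by rewrite invr_gt0 sqrtr_gt0 oval_q_gt0. Qed.

Lemma oval_qw p : oval_q p * oval_w p ^+ 2 = 1.
Proof.
rewrite /oval_w exprVn sqr_sqrtr ?ltW ?oval_q_gt0 //.
by rewrite divff // gt_eqF // oval_q_gt0.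
Qed.

Definition oval_c11 := g0 ^+ 2 * m ^+ 2 + g0 * r.
Definition oval_c12 := g0 ^+ 2 * m * n + g0 * s.
Definition oval_c22 := g0 ^+ 2 * n ^+ 2 + g0 * t.

(** [oval_A] and [oval_B] are half the partial derivatives of [oval_q]. *)
Definition oval_A p := (g0 ^+ 2 * m - oval_c11 * x0 - oval_c12 * y0)
  + oval_c11 * p.1 + oval_c12 * p.2.
Definition oval_B p := (g0 ^+ 2 * n - oval_c12 * x0 - oval_c22 * y0)
  + oval_c12 * p.1 + oval_c22 * p.2.

Let q00 := oval_q (0, 0).
Let A00 := oval_A (0, 0).
Let B00 := oval_B (0, 0).

Lemma oval_qE p : oval_q p = q00 + 2 * A00 * p.1 + 2 * B00 * p.2
  + oval_c11 * (p.1 * p.1) + 2 * oval_c12 * (p.1 * p.2) + oval_c22 * (p.2 * p.2).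
Proof.
by rewrite /q00 /A00 /B00 /oval_q /oval_A /oval_B /oval_c11 /oval_c12 /oval_c22 /=; ring.
Qed.

Lemma is_derive_oval_q p (v : R * R) :
  is_derive p v oval_q (2 * oval_A p * v.1 + 2 * oval_B p * v.2).
Proof.
have -> : oval_q = fun p => q00 + 2 * A00 * p.1 + 2 * B00 * p.2
  + oval_c11 * (p.1 * p.1) + 2 * oval_c12 * (p.1 * p.2) + oval_c22 * (p.2 * p.2).
  by apply/funext => q; exact: oval_qE.
apply: is_derive_by; eexists; first by leibniz.
by rewrite /A00 /B00 /oval_A /oval_B /=; ring.
Qed.

Lemma is_derive_oval_A p (v : R * R) :
  is_derive p v oval_A (oval_c11 * v.1 + oval_c12 * v.2).
Proof. by rewrite /oval_A; apply: is_derive_by; eexists; [leibniz | rewrite /=; ring]. Qed.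

Lemma is_derive_oval_B p (v : R * R) :
  is_derive p v oval_B (oval_c12 * v.1 + oval_c22 * v.2).
Proof. by rewrite /oval_B; apply: is_derive_by; eexists; [leibniz | rewrite /=; ring]. Qed.

Lemma is_derive_invsqrt (a : R) : 0 < a ->
  is_derive a 1 (fun a => (Num.sqrt a)^-1) (- 2^-1 * (Num.sqrt a)^-1 ^+ 3).
Proof.
move=> a0; have [ds es] := is_derive1_sqrt a0.
have sa0 : Num.sqrt a != 0 by rewrite gt_eqF // sqrtr_gt0.
split; first exact: derivableV.
rewrite deriveV // es /GRing.scale /=.
by field.
Qed.

Lemma is_derive_oval_w p (v : R * R) : is_derive p v oval_w
  (- (oval_A p * v.1 + oval_B p * v.2) * (oval_w p * (oval_w p * oval_w p))).
Proof.
have := is_derive_comp1 (is_derive_oval_q p v) (is_derive_invsqrt (oval_q_gt0 p)).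
by move/is_derive_eq; apply; rewrite -/(oval_w p); field.
Qed.

(** The algebra generated by [x], [y] and [oval_w] is stable under differentiation,
    which makes its members smooth. *)
Inductive oval_alg : (R * R -> R) -> Prop :=
| Oval_const c : oval_alg (fun=> c)
| Oval_fst : oval_alg (fun p => p.1)
| Oval_snd : oval_alg (fun p => p.2)
| Oval_w : oval_alg oval_w
| Oval_add F G : oval_alg F -> oval_alg G -> oval_alg (fun p => F p + G p)
| Oval_mul F G : oval_alg F -> oval_alg G -> oval_alg (fun p => F p * G p).

Lemma oval_alg_A : oval_alg oval_A.
Proof. by rewrite /oval_A; repeat constructor. Qed.

Lemma oval_alg_B : oval_alg oval_B.
Proof. by rewrite /oval_B; repeat constructor. Qed.

Lemma oval_alg_derive (v : R * R) F : oval_alg F -> exists2 F', oval_alg F' &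
  forall p, is_derive p v F (F' p).
Proof.
elim=> [c||||{}F G _ [F' aF' dF] _ [G' aG' dG]|{}F G aF [F' aF' dF] aG [G' aG' dG]].
- by exists (fun=> 0); [constructor|move=> p; exact: is_derive_const].
- by exists (fun=> v.1); [constructor|move=> p; exact: (is_derive_coordinates _ _).1].
- by exists (fun=> v.2); [constructor|move=> p; exact: (is_derive_coordinates _ _).2].
- exists (fun p => (-1) * (oval_A p * v.1 + oval_B p * v.2) *
    (oval_w p * (oval_w p * oval_w p))).
    by repeat first [exact: oval_alg_A | exact: oval_alg_B | constructor].
  by move=> p; rewrite mulN1r; exact: is_derive_oval_w.
- by exists (fun p => F' p + G' p); [constructor|move=> p; exact: is_derive_add].
- by exists (fun p => F' p * G p + F p * G' p); [repeat constructor|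
    move=> p; exact: is_derive_mul].
Qed.

Lemma oval_alg_continuous F p : oval_alg F -> {for p, continuous F}.
Proof.
elim=> [c||||{}F G _ cF _ cG|{}F G _ cF _ cG].
- exact: cst_continuous.
- exact: cvg_fst.
- exact: cvg_snd.
- have cq : {for p, continuous oval_q}.
    have -> : oval_q = fun p => q00 + 2 * A00 * p.1 + 2 * B00 * p.2
      + oval_c11 * (p.1 * p.1) + 2 * oval_c12 * (p.1 * p.2) + oval_c22 * (p.2 * p.2).
      by apply/funext => q; exact: oval_qE.
    repeat match goal with
      | |- {for _, continuous (fun=> _)} => exact: cst_continuous
      | |- {for _, continuous (fun p => p.1)} => exact: cvg_fst
      | |- {for _, continuous (fun p => p.2)} => exact: cvg_snd
      | |- {for _, continuous (fun p => @?F p + @?G p)} => apply: (@continuousD _ _ _ F G)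
      | |- {for _, continuous (fun p => @?F p * @?G p)} => apply: (@continuousM _ _ F G)
      end.
  apply: continuousV; first by rewrite gt_eqF // sqrtr_gt0 oval_q_gt0.
  by apply: continuous_comp => //; exact: sqrt_continuous.
- exact: continuousD.
- exact: continuousM.
Qed.

Lemma oval_alg_smooth Omega F : oval_alg F -> smooth_on Omega F.
Proof.
move=> aF w p _.
have aw : oval_alg (partials w F).
  elim: w => //= b w IH; case: b.
    have [F' aF' dF] := oval_alg_derive ((1 : R), (0 : R)) IH.
    by rewrite ((is_derive_partialP _ _).1 dF).
  have [F' aF' dF] := oval_alg_derive ((0 : R), (1 : R)) IH.
  by rewrite ((is_derive_partialP _ _).2 dF).
split; first exact: oval_alg_continuous.
  by have [F' _ /(_ p)[]] := oval_alg_derive ((1 : R), (0 : R)) aw.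
by have [F' _ /(_ p)[]] := oval_alg_derive ((0 : R), (1 : R)) aw.
Qed.

(** [oval_q * oval_w] is [sqrt oval_q], written inside the algebra. *)
Definition oval p := e0 + e1 * p.1 + e2 * p.2 + oval_q p * oval_w p.

Lemma oval_in_alg : oval_alg oval.
Proof.
have aq : oval_alg oval_q.
  have -> : oval_q = fun p => q00 + 2 * A00 * p.1 + 2 * B00 * p.2
    + oval_c11 * (p.1 * p.1) + 2 * oval_c12 * (p.1 * p.2) + oval_c22 * (p.2 * p.2).
    by apply/funext => q; exact: oval_qE.
  by repeat constructor.
by rewrite /oval; repeat first [exact: aq | constructor].
Qed.

Lemma oval_on_quadric p : (oval p - e0 - e1 * p.1 - e2 * p.2) ^+ 2 = oval_q p.
Proof.
transitivity (oval_q p * (oval_q p * oval_w p ^+ 2)); first by rewrite /oval; ring.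
by rewrite oval_qw mulr1.
Qed.

Let dA := is_derive_oval_A.
Let dB := is_derive_oval_B.
Let dw := is_derive_oval_w.
Let dq := is_derive_oval_q.

Ltac partial_by :=
  match goal with
  | |- partial_x _ = _ => apply: (is_derive_partialP _ _).1
  | |- partial_y _ = _ => apply: (is_derive_partialP _ _).2
  end => p;
  apply: is_derive_by; eexists; [by leibniz | rewrite /=].

Local Notation A := oval_A.
Local Notation B := oval_B.
Local Notation w := oval_w.
Local Notation c11 := oval_c11.
Local Notation c12 := oval_c12.
Local Notation c22 := oval_c22.

Lemma oval_x : partial_x oval = fun p => e1 + A p * w p.
Proof.
rewrite /oval; partial_by; transitivity (e1 + A p * w p * (2 - oval_q p * w p ^+ 2)); first by ring.
by rewrite oval_qw; ring.
Qed.

Lemma oval_y : partial_y oval = fun p => e2 + B p * w p.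
Proof.
rewrite /oval; partial_by; transitivity (e2 + B p * w p * (2 - oval_q p * w p ^+ 2)); first by ring.
by rewrite oval_qw; ring.
Qed.

Lemma oval_xx : partial_x (partial_x oval) =
  fun p => c11 * w p - A p * (A p * (w p * (w p * w p))).
Proof. by rewrite oval_x; partial_by; ring. Qed.

Lemma oval_xy : partial_x (partial_y oval) =
  fun p => c12 * w p - A p * (B p * (w p * (w p * w p))).
Proof. by rewrite oval_y; partial_by; ring. Qed.

Lemma oval_yy : partial_y (partial_y oval) =
  fun p => c22 * w p - B p * (B p * (w p * (w p * w p))).
Proof. by rewrite oval_y; partial_by; ring. Qed.

Lemma oval_xxx : partial_x (partial_x (partial_x oval)) = fun p =>
  3 * (A p * (A p * A p)) * (w p * (w p * (w p * (w p * w p))))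
  - 3 * c11 * A p * (w p * (w p * w p)).
Proof. by apply: (etrans (congr1 (@partial_x R) oval_xx)); partial_by; ring. Qed.

Lemma oval_yyy : partial_y (partial_y (partial_y oval)) = fun p =>
  3 * (B p * (B p * B p)) * (w p * (w p * (w p * (w p * w p))))
  - 3 * c22 * B p * (w p * (w p * w p)).
Proof. by apply: (etrans (congr1 (@partial_y R) oval_yy)); partial_by; ring. Qed.

Lemma oval_xxxx : partial_x (partial_x (partial_x (partial_x oval))) = fun p =>
  - 15 * A p ^+ 4 * w p ^+ 7 + 18 * c11 * A p ^+ 2 * w p ^+ 5 - 3 * c11 ^+ 2 * w p ^+ 3.
Proof. by apply: (etrans (congr1 (@partial_x R) oval_xxx)); partial_by; ring. Qed.

(** [det] expands the determinant of the homogenization of [oval_q] in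
    coordinates centred at [p]; it does not depend on [p], and the Hessian of
    [sqrt oval_q] is this determinant divided by [oval_q ^+ 2]. *)
Lemma oval_hessian p :
  partial 0 2 oval p * partial 2 0 oval p - partial 1 1 oval p ^+ 2
  = g0 ^+ 4 * (r * t - s ^+ 2) * w p ^+ 4.
Proof.
have det : (c11 * c22 - c12 ^+ 2) * oval_q p
    - (c11 * B p ^+ 2 + c22 * A p ^+ 2 - 2 * c12 * A p * B p)
    = g0 ^+ 4 * (r * t - s ^+ 2).
  by rewrite /oval_q /oval_A /oval_B /c11 /c12 /c22; ring.
rewrite -det.
have aux a b c : a = c22 * w p - B p * (B p * (w p * (w p * w p))) ->
    b = c11 * w p - A p * (A p * (w p * (w p * w p))) ->
    c = c12 * w p - A p * (B p * (w p * (w p * w p))) ->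
    a * b - c ^+ 2 = ((c11 * c22 - c12 ^+ 2) * oval_q p
    - (c11 * B p ^+ 2 + c22 * A p ^+ 2 - 2 * c12 * A p * B p)) * w p ^+ 4.
  move=> -> -> ->.
  transitivity ((c11 * c22 - c12 ^+ 2) * w p ^+ 2 * (1 : R)
    - (c11 * B p ^+ 2 + c22 * A p ^+ 2 - 2 * c12 * A p * B p) * w p ^+ 4); first by ring.
  by rewrite -(oval_qw p); ring.
exact: (aux _ _ _ (congr1 (@^~ p) oval_yy) (congr1 (@^~ p) oval_xx)
  (congr1 (@^~ p) oval_xy)).
Qed.

(** As the Hessian is positive, so is [f_xx * f_yy], hence both are nonzero. *)
Lemma oval_quadric Omega : quadric Omega oval.
Proof.
split.
  split; first exact: oval_alg_smooth oval_in_alg.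
  move=> p _; have hp : 0 < partial 0 2 oval p * partial 2 0 oval p - partial 1 1 oval p ^+ 2.
    by rewrite oval_hessian !mulr_gt0 ?exprn_gt0 ?oval_w_gt0 ?subr_gt0.
  have : partial 0 2 oval p * partial 2 0 oval p != 0.
    by rewrite gt_eqF // -(subrK (partial 1 1 oval p ^+ 2) (_ * _)) ltr_pwDl ?sqr_ge0.
  rewrite mulf_eq0 negb_or => /andP[n02 n20].
  by split; [exact: n02 | exact: n20 | rewrite gt_eqF].
exists (e1 ^+ 2 - c11), (2 * e1 * e2 - 2 * c12), (- 2 * e1), (e2 ^+ 2 - c22),
  (- 2 * e2), 1, (2 * e0 * e1 - 2 * A00), (2 * e0 * e2 - 2 * B00), (- 2 * e0),
  (e0 ^+ 2 - q00); split; first by rewrite oner_eq0 /= !orbT.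
move=> x y _ z; have := oval_on_quadric (x, y); rewrite oval_qE /= -/z => e.
transitivity ((z - e0 - e1 * x - e2 * y) ^+ 2 - (q00 + 2 * A00 * x + 2 * B00 * y
  + c11 * (x * x) + 2 * c12 * (x * y) + c22 * (y * y))); first by ring.
by rewrite e subrr.
Qed.

Lemma oval_jet (p := (x0, y0)) :
  [/\ oval p = e0 + e1 * x0 + e2 * y0 + g0, partial 1 0 oval p = e1 + m * g0 &
      partial 0 1 oval p = e2 + n * g0] /\
  [/\ partial 2 0 oval p = r, partial 1 1 oval p = s & partial 0 2 oval p = t] /\
  [/\ partial 3 0 oval p = - 3 * m * r, partial 0 3 oval p = - 3 * n * t &
      partial 4 0 oval p = 12 * m ^+ 2 * r - 3 * r ^+ 2 / g0].
Proof.
have g0_neq0 : g0 != 0 by rewrite gt_eqF.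
have Ap : A p = g0 ^+ 2 * m by rewrite /A /=; ring.
have Bp : B p = g0 ^+ 2 * n by rewrite /B /=; ring.
have qp : oval_q p = g0 ^+ 2 by rewrite /oval_q /=; ring.
have wp : w p = g0^-1 by rewrite /w qp sqrtr_sqr gtr0_norm.
have at_p (F F' : R * R -> R) d : F = F' -> F' p = d -> F p = d by move=> -> .
split; [split|split; split];
  [| apply: (at_p _ _ _ oval_x) | apply: (at_p _ _ _ oval_y)
   | apply: (at_p _ _ _ oval_xx) | apply: (at_p _ _ _ oval_xy)
   | apply: (at_p _ _ _ oval_yy) | apply: (at_p _ _ _ oval_xxx)
   | apply: (at_p _ _ _ oval_yyy) | apply: (at_p _ _ _ oval_xxxx)];
  by rewrite /oval /= ?Ap ?Bp ?qp ?wp /c11 /c12 /c22; field.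
Qed.

End OvalQuadric.

(** Inverting [oval_jet]: the third derivatives fix [m] and [n], and [a40] fixes [g0];
    the last hypothesis says that the resulting [g0] is positive. *)
Lemma oval_with_jet (R : realType) (x0 y0 a00 a10 a01 a20 a11 a02 a30 a03 a40 : R) :
  0 < a20 -> a11 ^+ 2 < a20 * a02 -> a40 * a20 * 3 < 4 * a30 ^+ 2 ->
  exists2 f : R * R -> R, forall Omega, quadric Omega f &
    [/\ [/\ f (x0, y0) = a00, partial 1 0 f (x0, y0) = a10 & partial 0 1 f (x0, y0) = a01],
        [/\ partial 2 0 f (x0, y0) = a20, partial 1 1 f (x0, y0) = a11 &
            partial 0 2 f (x0, y0) = a02] &
        [/\ partial 3 0 f (x0, y0) = a30, partial 0 3 f (x0, y0) = a03 &
            partial 4 0 f (x0, y0) = a40]].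
Proof.
move=> r0 h0 k0.
have r_neq0 : a20 != 0 by rewrite gt_eqF.
have t0 : 0 < a02.
  by rewrite -(pmulr_rgt0 _ r0); apply: le_lt_trans h0; exact: sqr_ge0.
have t_neq0 : a02 != 0 by rewrite gt_eqF.
pose k := 4 * a30 ^+ 2 - a40 * a20 * 3.
have kgt0 : 0 < k by rewrite subr_gt0.
have k_neq0 : k != 0 by rewrite gt_eqF.
(* The solution of a40 = 12 m^2 a20 - 3 a20^2 / g0. *)
pose g0 := 9 * a20 ^+ 3 / k.
have g0_gt0 : 0 < g0 by rewrite divr_gt0 // mulr_gt0 ?exprn_gt0.
pose m := - a30 / (3 * a20); pose n := - a03 / (3 * a02).
pose e1 := a10 - m * g0; pose e2 := a01 - n * g0.
pose e0 := a00 - e1 * x0 - e2 * y0 - g0.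
exists (oval x0 y0 g0 m n a20 a11 a02 e0 e1 e2).
  by move=> Omega; exact: oval_quadric.
have [[j00 j10 j01] [[j20 j11 j02] [j30 j03 j40]]] :=
  oval_jet x0 y0 m n e0 e1 e2 g0_gt0 r0 h0.
split; split; try assumption.
- by apply: (etrans j00); rewrite /e0 /e1 /e2; ring.
- by apply: (etrans j10); rewrite /e1; ring.
- by apply: (etrans j01); rewrite /e2; ring.
- by apply: (etrans j30); rewrite /m; field.
- by apply: (etrans j03); rewrite /n; field.
- apply: (etrans j40); rewrite /m /g0 /k; field.
  by rewrite r_neq0 k_neq0.
Qed.

(** * Normal forms modulo a differential ideal *)

(** Inductive, so that [normal_form_der_gen] and [morph_subring_gen] can follow how
    an element is generated. *)
Inductive subring_gen (A : pzRingType) (G : set A) : A -> Prop :=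
| Subring_in a : G a -> subring_gen G a
| Subring_1 : subring_gen G 1
| Subring_N a : subring_gen G a -> subring_gen G (- a)
| Subring_D a b : subring_gen G a -> subring_gen G b -> subring_gen G (a + b)
| Subring_M a b : subring_gen G a -> subring_gen G b -> subring_gen G (a * b).

Section NormalForms.
Context (P : comNzRingType) (S : mulrClosed P) (G : set P) (I : set (loc S)).
Hypotheses (SG : forall s, s \in S -> subring_gen G s).
Hypotheses (I0 : I 0) (ID : forall a b, I a -> I b -> I (a + b))
           (IM : forall a b, I b -> I (a * b)).

Local Notation L := (to_loc S).

(** Modulo [I], [T] is a fraction whose numerator is a polynomial in [G]. *)
Definition has_normal_form (T : loc S) : Prop :=
  exists s b, [/\ s \in S, subring_gen G b & I (L s * T - L b)].
Local Notation N := has_normal_form.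

Lemma normal_form_gen b : subring_gen G b -> N (L b).
Proof.
by exists 1, b; split; rewrite ?rpred1 // rmorph1 mul1r subrr.
Qed.

Lemma normal_form_ideal a : I a -> N a.
Proof.
move=> Ia; exists 1, (1 - 1); split; rewrite ?rpred1 //.
  by apply: Subring_D; [exact: Subring_1|apply: Subring_N; exact: Subring_1].
by rewrite subrr rmorph0 rmorph1 mul1r subr0.
Qed.

Lemma normal_formD a b : N a -> N b -> N (a + b).
Proof.
move=> [s [c [sS Gc Ia]]] [s' [c' [s'S Gc' Ib]]].
exists (s * s'), (c * s' + s * c'); split; first exact: rpredM.
  by apply: Subring_D; apply: Subring_M => //; exact: SG.
rewrite rmorphD !rmorphM.
have -> : L s * L s' * (a + b) - (L c * L s' + L s * L c') =
  L s' * (L s * a - L c) + L s * (L s' * b - L c') by ring.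
by apply: ID; exact: IM.
Qed.

Lemma normal_formM a b : N a -> N b -> N (a * b).
Proof.
move=> [s [c [sS Gc Ia]]] [s' [c' [s'S Gc' Ib]]].
exists (s * s'), (c * c'); split; [exact: rpredM|exact: Subring_M|].
rewrite !rmorphM.
have -> : L s * L s' * (a * b) - L c * L c' =
  L c' * (L s * a - L c) + (L s * a) * (L s' * b - L c') by ring.
by apply: ID; exact: IM.
Qed.

Lemma normal_formN a : N a -> N (- a).
Proof.
move=> Na; rewrite -mulN1r; apply: normal_formM => //.
have -> : -1 = L (- 1) by rewrite rmorphN rmorph1.
by apply: normal_form_gen; apply: Subring_N; exact: Subring_1.
Qed.

Lemma normal_form_nat n : N n%:R.
Proof.
rewrite -(rmorph_nat L); apply: normal_form_gen.
elim: n => [|n IH]; last by rewrite -natr1; apply: Subring_D => //; exact: Subring_1.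
rewrite mulr0n -(subrr 1).
by apply: Subring_D; [|apply: Subring_N]; exact: Subring_1.
Qed.

Lemma normal_formK s a : s \in S -> N (L s * a) -> N a.
Proof.
move=> sS [s' [c [s'S Gc Ia]]]; exists (s' * s), c; split=> //; first exact: rpredM.
by rewrite rmorphM -mulrA.
Qed.

Lemma ideal_cancel s a : s \in S -> I (L s * a) -> I a.
Proof.
move=> sS Ia.
have -> : a = frac 1 (exist _ s sS) * (L s * a).
  by rewrite mulrA [frac _ _ * _]mulrC (to_locV (exist _ s sS)) mul1r.
exact: IM.
Qed.

Section NormalFormDerivation.
Context (d : P -> P).
Hypotheses (derd : derivation d) (Id : forall a, I a -> I (loc_der d a)).
Hypothesis Gd : forall g, G g -> N (L (d g)).

Lemma normal_form_der_gen b : subring_gen G b -> N (L (d b)).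
Proof.
elim=> {b} [b /Gd //||b _ Nb|b c _ Nb _ Nc|b c Gb Nb Gc Nc].
- by rewrite (derivation1 derd) rmorph0; exact: normal_form_ideal.
- by rewrite (derivationN derd) rmorphN; exact: normal_formN.
- by rewrite (derivationD derd) rmorphD; exact: normal_formD.
- rewrite (derivationM derd) rmorphD !rmorphM.
  by apply: normal_formD; apply: normal_formM => //; exact: normal_form_gen.
Qed.

(** Differentiate [s * T = b] modulo [I] and solve for the derivative of [T]. *)
Lemma normal_form_der a : N a -> N (loc_der d a).
Proof.
move=> Na; have [s [c [sS Gc Ia]]] := Na; apply: (normal_formK sS).
have dl := loc_der_derivation S derd.
have := Id Ia; rewrite (derivationB dl) (derivationM dl) !(loc_der_to_loc _ derd).
move=> /normal_form_ideal H.
have -> : L s * loc_der d a =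
  (L (d s) * a + L s * loc_der d a - L (d c)) + (L (d c) + - (L (d s) * a)) by ring.
have Nds := normal_form_der_gen (SG sS); have Ndc := normal_form_der_gen Gc.
apply: normal_formD => //; apply: normal_formD => //.
by apply: normal_formN; exact: normal_formM.
Qed.

End NormalFormDerivation.
End NormalForms.

Section JetNormalForms.
Context (R : realType).
Local Notation S := (jet_S R).
Local Notation L := (to_loc S).
Local Notation Ds := [set @jet_Dx R; @jet_Dy R].

Definition quadric_ideal : set (jet_loc R) :=
  diff_ideal_gen Ds [set quadric_gen1 R; quadric_gen2 R].
Local Notation I := quadric_ideal.

Lemma quadric_ideal_diff_ideal : diff_ideal Ds I.
Proof.
split.
- by move=> J [[]].
- by move=> a b Ia Ib J JI; have [[_ JD _ _] _] := JI; apply: JD; [exact: Ia|exact: Ib].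
- by move=> a b Ib J JI; have [[_ _ JM _] _] := JI; apply: JM; exact: Ib.
- by move=> D iD a Ia J JI; have [[_ _ _ JDs] _] := JI; apply: JDs => //; exact: Ia.
Qed.

Lemma quadric_ideal_min (J : set (jet_loc R)) : diff_ideal Ds J ->
  J (quadric_gen1 R) -> J (quadric_gen2 R) -> I `<=` J.
Proof. by move=> dJ J1 J2 a; apply; split=> // b [|] ->. Qed.

Lemma quadric_ideal_gen1 : I (quadric_gen1 R).
Proof. by move=> J [_]; apply; left. Qed.

Lemma quadric_ideal_gen2 : I (quadric_gen2 R).
Proof. by move=> J [_]; apply; right. Qed.

(** Eleven coordinates, as many as the parameters of a quadric with a point on it:
    9 for the quadric and 2 for the point. *)
Definition parametric (v : jet_var) : bool :=
  if v is JD i j then (i + j <= 2)%N || ((i, j) \in [:: (3, 0); (0, 3); (4, 0)]%N)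
  else true.

Definition parametric_gen : set (jet_poly R) :=
  [set P | (exists c, P = pconst jet_var c) \/ exists2 v, parametric v & P = pvar R v].

Lemma parametric_var v : parametric v -> subring_gen parametric_gen (pvar R v).
Proof. by move=> pv; apply: Subring_in; right; exists v. Qed.

Lemma jet_S_parametric s : s \in S -> subring_gen parametric_gen s.
Proof.
move=> /asboolP; apply; split.
  by split; [exact: Subring_1 | exact: Subring_M].
have Gd i j : (i + j <= 2)%N -> subring_gen parametric_gen (jd R i j).
  by move=> le; apply: parametric_var; rewrite /= le.
move=> r /= [[|]|] ->; try exact: Gd.
apply: Subring_D; first by apply: Subring_M; exact: Gd.
by apply: Subring_N; apply: Subring_M; exact: Gd.
Qed.

Local Notation N := (has_normal_form parametric_gen I).

Let I0 : I 0. Proof. by have [] := quadric_ideal_diff_ideal. Qed.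
Let ID a b : I a -> I b -> I (a + b).
Proof. by have [_ + _ _] := quadric_ideal_diff_ideal; apply. Qed.
Let IM a b : I b -> I (a * b).
Proof. by have [_ _ + _] := quadric_ideal_diff_ideal; apply. Qed.
Let IDx a : I a -> I (jet_Dx a).
Proof. by have [_ _ _ H] := quadric_ideal_diff_ideal; apply: H; left. Qed.
Let IDy a : I a -> I (jet_Dy a).
Proof. by have [_ _ _ H] := quadric_ideal_diff_ideal; apply: H; right. Qed.

Lemma normal_form_var v : parametric v -> N (L (pvar R v)).
Proof. by move=> pv; apply: (normal_form_gen (S := S) (I := I) I0); exact: parametric_var. Qed.

Lemma normal_form_const c : N (L (pconst jet_var c)).
Proof. by apply: (normal_form_gen (S := S) (I := I) I0); apply: Subring_in; left; exists c. Qed.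

Let in_S r : [set jd R 0 2; jd R 2 0; jet_hess R] r -> r \in S.
Proof. exact: in_submonoid_gen. Qed.

Lemma morph_hess (A : comNzRingType) (C : pzRingType) (phi : {rmorphism A -> C}) (a b c : A) :
  phi (a * b - c ^+ 2) = phi a * phi b - phi c ^+ 2.
Proof. by rewrite rmorphB !rmorphM. Qed.

Lemma normal_form_nat_cancel n a : N (n.+1%:R * a) -> N a.
Proof.
move=> Na.
have -> : a = L (pconst jet_var (n.+1%:R)^-1) * (n.+1%:R * a).
  have nE : n.+1%:R = L (pconst jet_var n.+1%:R).
    by rewrite -(rmorph_nat L); congr L; exact: (esym (mpolyC_nat _ R n.+1)).
  rewrite mulrA [X in _ * X * _]nE -rmorphM.
  suff -> : pconst jet_var (n.+1%:R^-1 : R) * pconst jet_var n.+1%:R = 1.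
    by rewrite rmorph1 mul1r.
  by rewrite mkmalgUM mul1m mulVf ?pnatr_eq0.
apply: (normal_formM (S := S) (I := I) ID IM).
  exact: normal_form_const.
exact: Na.
Qed.

Let u i j : jet_loc R := L (jd R i j).

(** The derivatives of the parameters that are not parameters themselves. *)
Lemma normal_form_dependent_jets : [/\ N (u 2 1), N (u 1 2), N (u 3 1), N (u 1 3) & N (u 0 4)]
  /\ N (u 5 0) /\ N (u 4 1).
Proof.
have Nvar i j : parametric (JD i j) -> N (u i j) by exact: normal_form_var.
have ND := normal_formD (S := S) (G := parametric_gen) (I := I) jet_S_parametric ID IM.
have NN := normal_formN (S := S) (G := parametric_gen) (I := I) I0 ID IM.
have NM := normal_formM (S := S) (G := parametric_gen) (I := I) ID IM.
have Nn := normal_form_nat (S := S) (I := I) parametric_gen I0.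
have NI := normal_form_ideal (S := S) (I := I) parametric_gen.
have K r a : [set jd R 0 2; jd R 2 0; jet_hess R] r -> N (L r * a) -> N a.
  by move=> /in_S; exact: (normal_formK (S := S) (I := I)).
have rK a : N (u 2 0 * a) -> N a by apply: K; left; right.
have tK a : N (u 0 2 * a) -> N a by apply: K; left; left.
have hK a : N ((u 0 2 * u 2 0 - u 1 1 ^+ 2) * a) -> N a.
  by rewrite -(morph_hess L); apply: K; right.
have G1 := quadric_ideal_gen1.
have G2 := quadric_ideal_gen2.
rewrite /quadric_gen1 (morph_gen L) in G1.
rewrite /quadric_gen2 (morph_gen L) in G2.
have Dxu i j : jet_Dx (u i j) = u i.+1 j by exact: jet_Dx_var.
have Dyu i j : jet_Dy (u i j) = u i j.+1 by exact: jet_Dy_var.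
have Nlow i j : (i + j <= 2)%N -> N (u i j) by move=> le; apply: Nvar; rewrite /= le.
have o4 := order4 (jet_Dx_derivation R) (jet_Dy_derivation R) Dxu Dyu IDx IDy ND NN NM Nn NI
  Nlow (Nvar 3 0 isT) (Nvar 0 3 isT) (Nvar 4 0 isT) rK tK hK normal_form_nat_cancel G1 G2.
have o5 := order5 (jet_Dx_derivation R) (jet_Dy_derivation R) Dxu Dyu IDx IDy ND NN NM Nn NI
  Nlow (Nvar 3 0 isT) (Nvar 0 3 isT) (Nvar 4 0 isT) rK tK hK normal_form_nat_cancel G1 G2.
by split=> //; split; apply: o4.
Qed.

Lemma parametric_successors (U : nat -> nat -> Prop) :
  (forall i j, parametric (JD i j) -> U i j) ->
  [/\ U 2 1, U 1 2, U 3 1, U 1 3 & U 0 4] -> U 5 0 -> U 4 1 ->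
  forall i j, parametric (JD i j) -> U i.+1 j /\ U i j.+1.
Proof.
move=> par [U21 U12 U31 U13 U04] U50 U41 i j; rewrite /= !inE !xpair_eqE.
by case: i => [|[|[|[|[|i]]]]]; case: j => [|[|[|[|j]]]] //= _; split;
  first [assumption | exact: par].
Qed.

Lemma normal_form_jet_delta g : parametric_gen g ->
  N (L (pder (@jet_delta_x R) g)) /\ N (L (pder (@jet_delta_y R) g)).
Proof.
have [low [N50 N41]] := normal_form_dependent_jets.
have N0 : N 0 by exact: (normal_form_ideal (S := S) (I := I) parametric_gen I0).
have N1 : N 1 by exact: (normal_form_nat (S := S) (I := I) parametric_gen I0 1).
have Nvar i j : parametric (JD i j) -> N (u i j) by exact: normal_form_var.
have Neq a b : a = b -> N b -> N a by move=> ->.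
have NL0 : N (L 0) by exact: Neq (rmorph0 L) N0.
have NL1 : N (L 1) by exact: Neq (rmorph1 L) N1.
case=> [[c ->]|[v pv ->]].
  by split; apply: Neq (congr1 L (pder_const _ _)) NL0.
suff [Nx Ny] : N (L (@jet_delta_x R v)) /\ N (L (@jet_delta_y R v)).
  by split; apply: Neq (congr1 L (pder_var _ _)) _.
case: v pv => [_|_|i j]; [by split | by split |].
exact: (@parametric_successors (fun i j => N (u i j)) Nvar low N50 N41).
Qed.

(** Every jet is an iterated derivative of [u 0 0], so it is enough that the elements
    with a normal form are stable under both derivations. *)
Lemma all_normal_form T : N T.
Proof.
have ND := normal_formD (S := S) (G := parametric_gen) (I := I) jet_S_parametric ID IM.
have NM := normal_formM (S := S) (G := parametric_gen) (I := I) ID IM.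
have Nd (i j : nat) : N (u i j).
  have Ndx := normal_form_der (S := S) (I := I) jet_S_parametric I0 ID IM (pder_derivation (@jet_delta_x R))
    IDx (fun g Gg => (normal_form_jet_delta Gg).1).
  have Ndy := normal_form_der (S := S) (I := I) jet_S_parametric I0 ID IM (pder_derivation (@jet_delta_y R))
    IDy (fun g Gg => (normal_form_jet_delta Gg).2).
  elim: i => [|i IH]; last exact: eq_ind _ N (Ndx _ IH) _ (jet_Dx_var R (JD i j)).
  elim: j => [|j IH]; first exact: normal_form_var.
  exact: eq_ind _ N (Ndy _ IH) _ (jet_Dy_var R (JD 0 j)).
have NL r : N (L r).
  elim/mpoly_ind: r => [c|[||i j]|a b|a b].
  - exact: normal_form_const.
  - exact: normal_form_var.
  - exact: normal_form_var.
  - exact: Nd.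
  - by rewrite rmorphD; exact: ND.
  - by rewrite rmorphM; exact: NM.
elim/fracW: T => r s; apply: (normal_formK (S := S) (I := I) (valP s)).
by rewrite fracE mulrCA to_locV mulr1.
Qed.

End JetNormalForms.

(** * The annihilator of all quadrics *)

Lemma morph_subring_gen (A C : pzRingType) (G : set A) (phi psi : {rmorphism A -> C}) :
  (forall g, G g -> phi g = psi g) -> forall b, subring_gen G b -> phi b = psi b.
Proof.
move=> eqG b; elim=> {b} [b /eqG //||b _ e|b c _ eb _ ec|b c _ eb _ ec].
- by rewrite !rmorph1.
- by rewrite !rmorphN e.
- by rewrite !rmorphD eb ec.
- by rewrite !rmorphM eb ec.
Qed.

Lemma itv_infinite (R : realFieldType) (a e : R) n : 0 < e -> exists s : seq R,
  [/\ uniq s, size s = n & forall x, x \in s -> a < x < a + e].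
Proof.
move=> e0; exists [seq a + e * (k.+1%:R / n.+1%:R) | k <- iota 0 n]; split.
- rewrite map_inj_uniq ?iota_uniq // => i j /addrI/(mulfI (lt0r_neq0 e0)).
  move=> /(mulIf _) H; have /eqP := H (invr_neq0 (lt0r_neq0 (ltr0Sn R n))).
  by rewrite eqr_nat => /eqP[].
- by rewrite size_map size_iota.
- move=> x /mapP[k]; rewrite mem_iota add0n => /andP[_ kn] ->.
  rewrite ltrDl mulr_gt0 ?divr_gt0 ?ltr0Sn //= ltrD2l gtr_pMr //.
  by rewrite ltr_pdivrMr ?ltr0Sn // mul1r ltr_nat ltnS.
Qed.

Section Main.
Context (R : realType) (Omega : set (R * R)).
Hypotheses (Omega_nonempty : Omega !=set0) (Omega_open : open Omega).

Lemma quadric_ideal_annihilates f : quadric Omega f ->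
  @quadric_ideal R `<=` annihilator Omega [set f].
Proof.
move=> qf; have [g1 g2] := quadric_gens_annihilate Omega_open qf.
by apply: quadric_ideal_min => //; exact: annihilator1_diff_ideal Omega_open qf.1.
Qed.

(** [b] depends on the parametric jets only, and every point of a suitable box of
    values of these is attained by an oval at a point of [Omega]. *)
Lemma parametric_vanishing b : subring_gen (@parametric_gen R) b ->
  (forall f, quadric Omega f -> forall p, Omega p -> jet_eval f p b = 0) -> b = 0.
Proof.
move=> Gb vanish; have [[x0 y0] O0] := Omega_nonempty.
have [e e0 box] := nbhs_parallelogram ((1 : R), (0 : R)) ((0 : R), (1 : R))
  (open_nbhs_nbhs (conj Omega_open O0)).
have in_box x y : x0 < x < x0 + e -> y0 < y < y0 + e -> Omega (x, y).
  move=> /andP[x1 x2] /andP[y1 y2]; have := box (x - x0) (y - y0).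
  have -> : (x0, y0) + (x - x0) *: ((1 : R), (0 : R)) + (y - y0) *: ((0 : R), (1 : R))
      = (x, y).
    congr (_, _) => /=.
      by rewrite [_ *: 1]mulr1 [_ *: 0]mulr0 addr0 addrC subrK.
    by rewrite [_ *: 0]mulr0 [_ *: 1]mulr1 addr0 addrC subrK.
  by apply; apply/andP; split; lra.
(* On this box r > 1, t > 1 and 0 < s < 1 make the Hessian positive, and u40 < 0 < r
   makes the inequality on u30 and u40 automatic. *)
pose lo v := match v with JX => x0 | JY => y0
  | JD 2 0 | JD 0 2 => 1 | JD 4 0 => - 1 | _ => 0 end.
pose len v := match v with JX | JY => e | _ => 1 end.
have len_gt0 v : 0 < len v by case: v => [||i j] //=; exact: ltr01.
apply: (@peval_eq0_on_infinite_box _ R (fun v x => lo v < x < lo v + len v)).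
  by move=> v n; exact: itv_infinite.
move=> v vbox.
have bx := vbox JX; have b_y := vbox JY; have br := vbox (JD 2 0).
have bs := vbox (JD 1 1); have bt := vbox (JD 0 2); have b4 := vbox (JD 4 0).
rewrite /lo /len in bx b_y br bs bt b4.
have r0 : 0 < v (JD 2 0) by lra.
have h0 : v (JD 1 1) ^+ 2 < v (JD 2 0) * v (JD 0 2) by nra.
have k0 : v (JD 4 0) * v (JD 2 0) * 3 < 4 * v (JD 3 0) ^+ 2.
  have := sqr_ge0 (v (JD 3 0)); move: (v (JD 3 0) ^+ 2) => z; nra.
have [f qf [[j00 j10 j01] [j20 j11 j02] [j30 j03 j40]]] :=
  oval_with_jet (v JX) (v JY) (v (JD 0 0)) (v (JD 1 0)) (v (JD 0 1)) (v (JD 0 3)) r0 h0 k0.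
apply: etrans (vanish f (qf Omega) (v JX, v JY) (in_box _ _ bx b_y)).
have agree i : parametric i -> v i = jet_val f (v JX, v JY) i.
  case: i => [||i j] //; rewrite /parametric !inE !xpair_eqE => par.
  apply: esym; change (partial i j f (v JX, v JY) = v (JD i j)); move: par.
  by case: i => [|[|[|[|[|i]]]]]; case: j => [|[|[|[|j]]]].
apply: (@morph_subring_gen _ _ _ (peval v) (jet_eval f (v JX, v JY))) Gb.
move=> g [[c ->]|[i pi ->]]; first by rewrite /= /jet_eval !peval_const.
by rewrite /= /jet_eval !peval_var; exact: agree.
Qed.

End Main.

Theorem proposition3p3 (R : realType) (Omega : set (R * R))
    (Omega_nonempty : Omega !=set0) (Omega_open : open Omega)
    (Omega_connected : connected Omega) :
  annihilator Omega (quadric Omega) =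
  diff_ideal_gen [set @jet_Dx R; @jet_Dy R]
    [set quadric_gen1 R; quadric_gen2 R].
Proof.
apply/seteqP; split=> T; last first.
  move=> IT f qf p Op.
  by have := quadric_ideal_annihilates Omega_open qf IT; apply.
move=> annT; have [s [b [sS Gb Ib]]] := all_normal_form T.
have b0 : b = 0.
  apply: (parametric_vanishing Omega_nonempty Omega_open Gb) => f qf.
  have [A0 AD AM _] := annihilator1_diff_ideal Omega_open qf.1.
  have annTf : annihilator Omega [set f] T.
    by move=> g -> p Op; exact: annT.
  have Ab := quadric_ideal_annihilates Omega_open qf Ib.
  apply/(annihilator1_frac qf.1 b (den1 (jet_S R))).
  have -> : frac b (den1 (jet_S R)) = to_loc (jet_S R) s * T
      + (-1) * (to_loc (jet_S R) s * T - to_loc (jet_S R) b).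
    by rewrite mulN1r opprB addrCA subrr addr0.
  by apply: AD; apply: AM.
have [_ _ IM _] := quadric_ideal_diff_ideal R.
apply: (ideal_cancel (S := jet_S R) (I := @quadric_ideal R) IM sS).
by move: Ib; rewrite b0 rmorph0 subr0.
Qed.
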